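(* Let $u\in U$ be fixed with $g(u,\boldsymbol m)<0$, let $p=\mathbb P(g(u,\boldsymbol\zeta)\le 0)$, and set $$\rho^{\inf}:=\inf\{\rho(u,\boldsymbol v):\boldsymbol v\in\mathbb S^{n-1}\},\qquad \rho^{\sup}:=\sup\{\rho(u,\boldsymbol v):\boldsymbol v\in\mathbb S^{n-1}\}.$$ Then $$\operatorname{V}_{\mathrm{SRD}}\le\min\bigl\{(1-p)\,(p-F_\chi(\rho^{\inf})),\;p\,(F_\chi(\rho^{\sup})-p)\bigr\}.$$
   Context: $U$ is a Banach space, $g:U\times\mathbb R^n\to\mathbb R$ is such that $g(u,\cdot)$ is convex for every $u\in U$, and $\boldsymbol\zeta\sim\mathcal N(\boldsymbol m,\Sigma)$ is a nondegenerate $n$-dimensional Gaussian random vector. $L\in\mathbb R^{n\times n}$ satisfies $LL^T=\Sigma$. $\mathbb S^{n-1}$ is the Euclidean unit sphere of $\mathbb R^n$. For $u$ with $g(u,\boldsymbol m)<0$ and $\boldsymbol v\in\mathbb S^{n-1}$, $$\rho(u,\boldsymbol v):=\sup\{r\ge0:g(u,\boldsymbol m+rL\boldsymbol v)\le0\}\in[0,\infty].$$ $F_\chi$ is the (cumulative) distribution function of the one-dimensional Chi-distribution with $n$ degrees of freedom, with the convention $F_\chi(\infty)=1$. With $\boldsymbol\theta$ uniformly distributed on $\mathbb S^{n-1}$, $$\operatorname{V}_{\mathrm{SRD}}:=\operatorname{Var}F_\chi(\rho(u,\boldsymbol\theta))$$ is the variance of the elementary spherical-radial estimator of $p$. It is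 a known fact (spherical-radial decomposition) that $p=\mathbb P(g(u,\boldsymbol\zeta)\le0)=\mathbb E F_\chi(\rho(u,\boldsymbol\theta))$. *)

(* Defs.v *)
From HB Require Import structures.
From mathcomp Require Import all_boot all_order all_algebra.
From mathcomp Require Import all_classical all_reals all_analysis.

Set Implicit Arguments.
Unset Strict Implicit.
Unset Printing Implicit Defensive.

Import Order.TTheory GRing.Theory Num.Theory.
Import numFieldNormedType.Exports.

Local Open Scope classical_set_scope.
Local Open Scope ring_scope.

(* 'cV[R]_n with its Borel sigma-algebra. The library norm `|x| on 'cV[R]_n is
   the sup norm; it has the same open sets as the Euclidean norm enorm. *)
Notation Rvec R n := (g_sigma_algebraType (open : set (set 'cV[R]_n))).

Definition enorm (R : realType) (n : nat) (x : 'cV[R]_n) : R :=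
  Num.sqrt (\sum_(i < n) x i 0 ^+ 2).

Definition sphere (R : realType) (n : nat) : set 'cV[R]_n :=
  [set v | enorm v = 1].

Definition std_normal_law (R : realType) (n : nat)
    (gamma : probability (Rvec R n) R) : Prop :=
  forall A : 'I_n -> set R, (forall i, measurable (A i)) ->
    gamma [set x : 'cV[R]_n | forall i, A i (x i 0)] =
    (\prod_(i < n) normal_prob 0 1 (A i))%E.

(* N(m, Sigma): the law of m + A Z, for a standard normal vector Z and a matrix
   A with A A^T = Sigma. *)
Definition normal_law (R : realType) (n : nat) (m : 'cV[R]_n) (Sigma : 'M[R]_n)
    (mu : probability (Rvec R n) R) : Prop :=
  exists (gamma : probability (Rvec R n) R) (A : 'M[R]_n),
    [/\ std_normal_law gamma, A *m A^T = Sigma &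
        forall B : set (Rvec R n), measurable B ->
          mu B = gamma [set x : 'cV[R]_n | B (m + A *m x)]].

(* The uniform distribution on the sphere is the only probability measure
   concentrated on the sphere that is invariant under all orthogonal maps. *)
Definition uniform_sphere_law (R : realType) (n : nat)
    (mu : probability (Rvec R n) R) : Prop :=
  mu (@sphere R n) = 1%E /\
  forall O : 'M[R]_n, O^T *m O = 1%:M ->
    forall B : set (Rvec R n), measurable B ->
      mu [set x : 'cV[R]_n | B (O *m x)] = mu B.

Definition gamma_fun (R : realType) (a : R) : R :=
  \int[lebesgue_measure]_(x in `]0, +oo[) (x `^ (a - 1) * expR (- x)).

(* Density, on [0, +oo[, of the chi-distribution with n > 0 degrees of freedom. *)
Definition chi_pdf (R : realType) (n : nat) (x : R) : R :=
  x ^+ n.-1 * expR (- (x ^+ 2 / 2)) /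
  (2 `^ (n%:R / 2 - 1) * gamma_fun (n%:R / 2)).

Definition chi_cdf (R : realType) (n : nat) (r : \bar R) : R :=
  match r with
  | r%:E => \int[lebesgue_measure]_(x in `[0, r]) chi_pdf n x
  | +oo%E => 1
  | -oo%E => 0
  end.

Section radius.
Context {R : realType} {n : nat} {U : Type}.
Variables (g : U -> 'cV[R]_n -> R) (m : 'cV[R]_n) (L : 'M[R]_n) (u : U).

Definition rho (v : 'cV[R]_n) : \bar R :=
  ereal_sup [set r%:E | r in [set r : R | 0 <= r /\
                                           g u (m + r *: (L *m v)) <= 0]].

Definition rho_inf : \bar R := ereal_inf (rho @` sphere (n := n)).

Definition rho_sup : \bar R := ereal_sup (rho @` sphere (n := n)).

Definition srd_variance d (T : measurableType d) (Q : probability T R)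
    (theta : T -> 'cV[R]_n) : \bar R :=
  'V_Q[fun w => chi_cdf n (rho (theta w))]%E.

End radius.

(* Main.v *)
(** Write C for the closed convex set of all x with g(u, m + L x) <= 0. Along each ray
    C is an interval [0, rho v], so F_chi(rho v) is the standard Gaussian measure
    of the x with |x| v in C, once the radial law of the Gaussian is known; the
    latter follows because e^(|x|^2/2) gamma(dx) is homogeneous of degree n.
    Averaging over the uniform law sigma gives E F_chi(rho theta) = p: for open B
    and the kernel K_e(x, v) = [|x - |x| v| <= e |x|], rotation invariance makes
    sigma(K_e(x, .)) = h_e independent of x <> 0 and |x| independent of K_e under
    gamma, so that the law of |x| v gives B the mass
    h_e^-1 int sigma(v : K_e(x, v), |x| v in B) gamma(dx), and Fatou's lemma as
    e -> 0 bounds this below by gamma(B). Given the mean p, the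
    variance bound is the Bhatia-Davis inequality on [F_chi(rho_inf), 1] and on
    [0, F_chi(rho_sup)]. *)

From HB Require Import structures.
Require Import Defs.
From mathcomp Require Import all_boot all_order all_algebra.
From mathcomp Require Import all_classical all_reals all_analysis.
From mathcomp Require Import measurable_realfun.
From mathcomp Require Import ring lra.

Set Implicit Arguments.
Unset Strict Implicit.
Unset Printing Implicit Defensive.

Import Order.TTheory GRing.Theory Num.Theory.
Import numFieldNormedType.Exports.
Import HBNNSimple.

Local Open Scope classical_set_scope.
Local Open Scope ring_scope.

(** The laws are given by characterisations: [std_normal_law] fixes the masses of boxes,
    [uniform_sphere_law] the mass of the sphere and the invariance. So the geometry of the Gaussian
    has to be extracted from its product structure. Scaling is treated one coordinate at a time, and
    rotation invariance through coordinate planes, where Lebesgue measure on the plane can be used;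
    enough symmetries of [gamma] result to move any unit vector to any other. The main obstacle is
    to relate [sigma] to the direction of a Gaussian vector, which amounts to uniqueness of the
    invariant law. The kernel takes the place of an average over the orthogonal group: by Tonelli,
    fixing x or fixing v yields the same constant h_e. This constant is never computed; it has to be
    positive, and then it cancels. Fatou gives only an inequality, and only for open sets. Since
    both measures are probabilities, applying it to the complement of C and to open sublevel sets
    shrinking to C gives equality on C. Closedness and measurability of C rest on the continuity of
    g(u, .), which is deduced from convexity in finite dimension. *)

(** * Measures given by a density *)

Section density.
Context d (T : measurableType d) (R : realType).
Variables (mu : {measure set T -> \bar R}) (f : T -> R).
Hypotheses (f0 : forall x, 0 <= f x) (mf : measurable_fun setT f).
Local Open Scope ereal_scope.

(** The two proofs are arguments so that the term itself determines the measure structure declared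
    for it below. *)
Definition density_measure (_ : forall x, (0 <= f x)%R)
  (_ : measurable_fun setT f) (A : set T) : \bar R := \int[mu]_(x in A) (f x)%:E.

Local Notation nu := (density_measure f0 mf).

Let nu0 : nu set0 = 0. Proof. exact: integral_set0. Qed.

Let nu_ge0 A : 0 <= nu A.
Proof. by apply: integral_ge0 => x _; rewrite lee_fin. Qed.

Let nu_sigma_additive : semi_sigma_additive nu.
Proof.
move=> F mF tF mUF; rewrite /density_measure ge0_integral_bigcup//; last 2 first.
  by apply/measurable_EFinP; exact: measurable_funTS.
  by move=> x _; rewrite lee_fin.
by apply: is_cvg_ereal_nneg_natsum_cond => n _ _; exact: nu_ge0.
Qed.

HB.instance Definition _ :=
  isMeasure.Build _ _ _ nu nu0 nu_ge0 nu_sigma_additive.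

(** Both sides are limits, by monotone convergence, along the simple functions [nnsfun_approx]; for
    a simple function the identity is linearity together with the value of the measure on level
    sets. *)
Lemma integral_density (g : T -> \bar R) :
  measurable_fun setT g -> (forall x, 0 <= g x) ->
  \int[nu]_x g x = \int[mu]_x (g x * (f x)%:E).
Proof.
move=> mg g0; pose h := nnsfun_approx measurableT mg.
have mfE : measurable_fun setT (fun x => (f x)%:E) by exact/measurable_EFinP.
have hg x : (h n x)%:E @[n --> \oo] --> g x.
  by apply: cvg_nnsfun_approx => // y _; exact: g0.
have -> : \int[nu]_x g x = lim (\int[nu]_x (h n x)%:E @[n --> \oo]).
  rewrite -monotone_convergence//.
  - by apply: eq_integral => x _; apply/esym/cvg_lim => //; exact: hg.
  - by move=> n; apply/measurable_EFinP; exact/measurable_funP.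
  - by move=> n x _; rewrite lee_fin.
  - by move=> x _ a b ab; rewrite lee_fin; exact/lefP/nd_nnsfun_approx.
have -> : \int[mu]_x (g x * (f x)%:E) =
    lim (\int[mu]_x ((h n x)%:E * (f x)%:E) @[n --> \oo]).
  rewrite -monotone_convergence//.
  - apply: eq_integral => x _; apply/esym/cvg_lim => //.
    by apply: cvgeZr => //; exact: hg.
  - by move=> n; apply: emeasurable_funM => //; exact/measurable_EFinP/measurable_funP.
  - by move=> n x _; rewrite mule_ge0 ?lee_fin.
  - move=> x _ a b ab; rewrite lee_wpmul2r ?lee_fin//.
    exact/lefP/nd_nnsfun_approx.
congr (limn _); apply/funext => n.
have mhr r : measurable (h n @^-1` [set r]) by exact: measurable_funPTI.
under [LHS]eq_integral do rewrite fimfunE -fsumEFin//.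
rewrite ge0_integral_fsum//; last 2 first.
- by move=> y; exact/measurable_EFinP/measurable_funM.
- by move=> y x _; rewrite nnfun_muleindic_ge0.
under [RHS]eq_integral => x _.
  rewrite fimfunE -fsumEFin// ge0_mule_fsuml; last first.
    by move=> y; exact: nnfun_muleindic_ge0.
  over.
rewrite ge0_integral_fsum//; last 2 first.
- move=> y; apply: emeasurable_funM => //.
  by apply: measurableT_comp => //; apply: measurable_funM.
- by move=> y x _; rewrite mule_ge0 ?lee_fin// -lee_fin EFinM nnfun_muleindic_ge0.
apply: eq_fsbigr => r /[!inE] -[t _ hr].
have r0 : (0 <= r)%R by rewrite -hr.
under [LHS]eq_integral do rewrite EFinM.
under [RHS]eq_integral do rewrite EFinM -muleA.
rewrite ge0_integralZl ?lee_fin//; last first.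
  by apply/measurable_EFinP; exact: measurable_indic.
rewrite ge0_integralZl ?lee_fin//; last 2 first.
- apply: emeasurable_funM => //; apply/measurable_EFinP; exact: measurable_indic.
- by move=> x _; rewrite mule_ge0 ?lee_fin.
congr (_ * _); rewrite integral_indic// setIT [LHS]integral_mkcond.
by apply: eq_integral => x _; rewrite epatch_indic muleC.
Qed.

Lemma integral_density_in (A : set T) (g : T -> \bar R) : measurable A ->
  measurable_fun setT g -> (forall x, 0 <= g x) ->
  \int[nu]_(x in A) g x = \int[mu]_(x in A) (g x * (f x)%:E).
Proof.
move=> mA mg g0; rewrite [LHS]integral_mkcond [RHS]integral_mkcond.
rewrite integral_density//; last 2 first.
- exact/(measurable_restrictT _ _).1/measurable_funTS.
- by move=> x; apply: erestrict_ge0.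
by apply: eq_integral => x _; rewrite !patchE; case: ifP; rewrite ?mul0e.
Qed.

End density.

(** * Lebesgue measure under affine maps *)

Section lebesgue_affine.
Context {R : realType}.
Local Notation mu := (@lebesgue_measure R).
Implicit Types (a b c : R) (A : set R).

Lemma measurable_fun_affine a b :
  measurable_fun setT (fun x : measurableTypeR R => (a * x + b)%R : measurableTypeR R).
Proof. by apply: measurable_funD => //; exact: measurable_funM. Qed.

(** By uniqueness of Lebesgue measure: [a] times the image of [mu] under the affine map gives every
    half-open interval its length. *)
Lemma lebesgue_measure_affine (a b : R) A : 0 < a -> measurable A ->
  (mu [set x | A (a * x + b)%R] = (a^-1)%:E * mu A)%E.
Proof.
move=> a0 mA.
pose nu := pushforward mu (fun x : measurableTypeR R => (a * x + b)%R : measurableTypeR R).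
pose ai := NngNum (ltW a0).
have nuE (X : set R) : ocitv X -> mu X = mscale ai nu X.
  move=> [[c d] _ <-]; rewrite /mscale/= /nu /pushforward.
  have -> : (fun x => a * x + b) @^-1` `]c, d]%classic
      = `](c - b) / a, (d - b) / a]%classic.
    apply/seteqP; split => x /=; rewrite !in_itv/=.
      move=> /andP[h1 h2]; apply/andP; split.
        by rewrite ltr_pdivrMr// ltrBlDr mulrC.
      by rewrite ler_pdivlMr// lerBrDr mulrC.
    rewrite ltr_pdivrMr// ltrBlDr mulrC => /andP[h1].
    by rewrite ler_pdivlMr// lerBrDr mulrC h1 => ->.
  rewrite !lebesgue_measure_itv/= !lte_fin ltr_pM2r ?invr_gt0// ltrD2r.
  case: ifPn => _; last by rewrite mule0.
  rewrite -!EFinD -EFinM; congr EFin.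
  by rewrite -mulrBl mulrCA divff ?gt_eqF// mulr1; ring.
have mnu : measurable_fun setT (fun x : measurableTypeR R => (a * x + b)%R : measurableTypeR R).
  exact: measurable_fun_affine.
pose nu' : {measure set (measurableTypeR R) -> \bar R} :=
  mscale ai (pushforward mu (fun x : measurableTypeR R => (a * x + b)%R : measurableTypeR R)).
have := @lebesgue_measure_unique R (nu' mnu) (nuE mnu) A mA.
rewrite /nu' /mscale/= /pushforward => ->.
by rewrite muleA -EFinM mulVf ?gt_eqF// mul1e.
Qed.

Lemma lebesgue_measure_translation b A : measurable A ->
  mu [set x | A (x + b)] = mu A.
Proof.
move=> mA; have := lebesgue_measure_affine b ltr01 mA.
by rewrite invr1 mul1e => <-; congr (mu _); apply/funext => x /=; rewrite mul1r.
Qed.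

End lebesgue_affine.

(** * Boxes and Borel sets *)

Section box.
Context {R : realType} {n : nat}.
Implicit Types (A : 'I_n -> set R) (U : set 'cV[R]_n).

Definition box A : set 'cV[R]_n := [set x | forall i, A i (x i 0)].

Lemma boxI A A' : box A `&` box A' = box (fun i => A i `&` A' i).
Proof.
by apply/seteqP; split => x; [case=> h h' i; split|move=> h; split=> i; case: (h i)].
Qed.

Lemma boxT : box (fun=> setT) = setT.
Proof. exact/seteqP. Qed.

(** Half-open cubes of side 1/(k+1). Their index type is countable, so that open sets, and later the
    sphere, are handled through countable unions of small cells. *)
Definition grid_cell (k : nat) (z : {ffun 'I_n -> int}) : set 'cV[R]_n :=
  box (fun i => [set t | Num.floor (k.+1%:R * t) = z i]).

Lemma grid_cell_cover k (x : 'cV[R]_n) : grid_cell k [ffun i => Num.floor (k.+1%:R * x i 0)] x.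
Proof. by move=> i; rewrite /= ffunE. Qed.

Lemma grid_cell_dist k z (x y : 'cV[R]_n) : grid_cell k z x -> grid_cell k z y ->
  forall i, `|x i 0 - y i 0| < k.+1%:R^-1.
Proof.
move=> zx zy i; have k0 : 0 < k.+1%:R :> R by [].
have := floor_itv (k.+1%:R * x i 0); have := floor_itv (k.+1%:R * y i 0).
rewrite (zx i) (zy i) intrD => /andP[y1 y2] /andP[x1 x2].
rewrite -(ltr_pM2l k0) mulfV ?gt_eqF// -[X in X * _]gtr0_norm// -normrM mulrBr.
by rewrite ltr_norml; apply/andP; split; lra.
Qed.

Lemma measurable_floor_fiber (k : nat) (m : int) :
  measurable [set t : R | Num.floor (k.+1%:R * t) = m].
Proof.
have k0 : 0 < k.+1%:R :> R by [].
suff -> : [set t : R | Num.floor (k.+1%:R * t) = m] =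
    `[m%:~R / k.+1%:R, (m + 1)%:~R / k.+1%:R[%classic by exact: measurable_itv.
apply/seteqP; split => t /=; rewrite in_itv/= ler_pdivrMr// ltr_pdivlMr//.
  by move=> <-; rewrite mulrC; exact: floor_itv.
by rewrite mulrC => h; exact: floor_def.
Qed.

Lemma open_bigcup_grid_cell U : open U ->
  U = \bigcup_(p : nat * {ffun 'I_n -> int})
        [set x | grid_cell p.1 p.2 x /\ grid_cell p.1 p.2 `<=` U].
Proof.
move=> oU; apply/seteqP; split => x; last by case=> p _ [px]; exact.
move=> Ux; have /nbhs_ballP[e /= e0 eU] := open_nbhs_nbhs (conj oU Ux).
have [k] := @ltr_add_invr R 0 e e0; rewrite add0r => ke.
exists (k, [ffun i => Num.floor (k.+1%:R * x i 0)]) => //=.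
split; first exact: grid_cell_cover.
move=> y xy; apply: eU; split => // i j; rewrite (ord1 j) /ball/=.
by apply: lt_trans ke; exact: (grid_cell_dist (grid_cell_cover k x) xy).
Qed.

(** An open set is a countable union of grid cells, which are boxes with measurable sides, so
    control of the preimages of boxes is enough. *)
Lemma open_box_measurable d (T : measurableType d) (f : T -> 'cV[R]_n) U :
  (forall A, (forall i, measurable (A i)) -> measurable (f @^-1` box A)) ->
  open U -> measurable (f @^-1` U).
Proof.
move=> mf /open_bigcup_grid_cell ->; rewrite preimage_bigcup.
apply: countable_bigcupT_measurable => // -[k z]/=.
have [zU|zU] := pselect (grid_cell k z `<=` U); last first.
  rewrite [X in measurable X](_ : _ = set0)//; apply/seteqP; split => // t [_].
  by move/zU.
rewrite [X in measurable X](_ : _ = f @^-1` grid_cell k z).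
  by apply: mf => i; exact: measurable_floor_fiber.
by apply/seteqP; split => t; [case|split].
Qed.

Lemma measurable_coord (i : 'I_n) :
  measurable_fun setT (fun x : Rvec R n => (x : 'cV[R]_n) i 0).
Proof.
apply: (measurability _ (RGenOpens.measurableE R)) => _ [_ [a [b ->]] <-].
rewrite setTI; apply: sub_sigma_algebra.
apply: open_comp (interval_open _ _) => // x _; exact: coord_continuous.
Qed.

Lemma measurable_box A : (forall i, measurable (A i)) ->
  measurable (box A : set (Rvec R n)).
Proof.
move=> mA; rewrite [X in measurable X](_ : _ =
  \bigcap_(i in [set: 'I_n]) ((fun x : 'cV[R]_n => x i 0) @^-1` A i)).
  by apply: fin_bigcap_measurable => // i _; rewrite -[X in measurable X]setTI;
    exact: measurable_coord.
apply/seteqP; split => x.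
  by move=> Ax i _ /=; exact: Ax.
by move=> Ax i; exact: Ax.
Qed.

Lemma measurable_fun_Rvec d (T : measurableType d) (f : T -> 'cV[R]_n) :
  (forall i, measurable_fun setT (fun t => f t i 0)) ->
  measurable_fun setT (f : T -> Rvec R n).
Proof.
move=> mf; apply: (@measurability _ _ T (Rvec R n) setT f (open : set (set 'cV[R]_n)) erefl).
move=> _ [U oU <-].
rewrite setTI; apply: open_box_measurable oU => A mA.
rewrite [X in measurable X](_ : _ =
  \bigcap_(i in [set: 'I_n]) ((fun t => f t i 0) @^-1` A i)).
  by apply: fin_bigcap_measurable => // i _; rewrite -[X in measurable X]setTI; exact: mf.
apply/seteqP; split => x.
  by move=> Ax i _ /=; exact: Ax.
by move=> Ax i; exact: Ax.
Qed.

(** Boxes are stable under intersection and, by [open_box_measurable] for the identity map, generate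
    the Borel sets. As [std_normal_law] speaks of boxes, every transformation rule for the Gaussian
    below passes through this lemma. *)
Lemma Rvec_measure_unique (m1 m2 : {measure set (Rvec R n) -> \bar R}) :
  (m1 setT < +oo)%E ->
  (forall A, (forall i, measurable (A i)) -> m1 (box A) = m2 (box A)) ->
  forall B : set (Rvec R n), measurable B -> m1 B = m2 B.
Proof.
move=> m1oo m12 B mB.
pose G : set (set (Rvec R n)) :=
  [set X | exists2 A, (forall i, measurable (A i)) & X = box A].
apply: (measure_unique G (fun=> setT)) => //.
- apply/seteqP; split; last first.
    apply: smallest_sub; first exact: sigma_algebra_measurable.
    by move=> _ [A mA ->]; exact: measurable_box.
  apply: smallest_sub; first exact: smallest_sigma_algebra.
  move=> U oU; have := @open_box_measurable _ (g_sigma_algebraType G) id U.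
  rewrite preimage_id; apply => // A mA; apply: sub_sigma_algebra.
  by exists A.
- move=> _ _ [A mA ->] [A' mA' ->]; rewrite boxI; exists (fun i => A i `&` A' i) => //.
  by move=> i; exact: measurableI.
- by move=> _; exists (fun=> setT); rewrite ?boxT.
- by rewrite bigcup_const//; exists 0%N.
- by move=> _ [A mA ->]; exact: m12.
Qed.

End box.

(** * Scaling of the standard Gaussian *)

Section product_density.
Context {R : realType} {n : nat}.
Local Open Scope ereal_scope.

Lemma integral_normal_prob (g : R -> \bar R) (A : set R) : measurable A ->
  measurable_fun setT g -> (forall x, 0 <= g x) ->
  \int[normal_prob 0%R 1%R]_(x in A) g x =
  \int[lebesgue_measure]_(x in A) (g x * (normal_pdf 0 1 x)%:E).
Proof.
move=> mA mg g0; rewrite -(integral_density_in lebesgue_measure (@normal_pdf_ge0 R 0 1)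
  (@measurable_normal_pdf R 0 1))//.
Qed.

(* The density with respect to N(0,1) of the law of t Z, for Z ~ N(0,1). *)
Definition scaling_density (t x : R) : R :=
  (t^-1 * expR (x ^+ 2 * (1 - t ^- 2) / 2))%R.

Lemma scaling_density_ge0 t x : (0 < t)%R -> (0 <= scaling_density t x)%R.
Proof. by move=> t0; rewrite mulr_ge0 ?expR_ge0// invr_ge0 ltW. Qed.

Lemma measurable_scaling_density t : measurable_fun setT (scaling_density t).
Proof.
apply: measurable_funM => //; apply: measurableT_comp => //.
by apply: measurable_funM => //; apply: measurable_funM.
Qed.

(** Substitution y = t x: the image of Lebesgue measure is t^-1 times itself, and the quotient of
    the normal densities at y / t and at y is the exponential in [scaling_density]. *)
Lemma normal_prob_scaling (t : R) (A : set R) : (0 < t)%R -> measurable A ->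
  normal_prob 0%R 1%R [set x | A (t * x)%R] =
  \int[normal_prob 0%R 1%R]_(x in A) (scaling_density t x)%:E.
Proof.
move=> t0 mA; rewrite integral_normal_prob//; last 2 first.
- by apply/measurable_EFinP; exact: measurable_scaling_density.
- by move=> x; rewrite lee_fin scaling_density_ge0.
have tN0 : t != 0%R by rewrite gt_eqF.
pose g y : R := normal_pdf 0 1 (y / t)%R.
pose phi : measurableTypeR R -> measurableTypeR R := fun x => (t * x + 0)%R.
have mphi : measurable_fun setT phi by exact: measurable_fun_affine.
have g0 y : (0 <= g y)%R by exact: normal_pdf_ge0.
have mg : measurable_fun setT g.
  by apply: measurableT_comp; [exact: measurable_normal_pdf|exact: measurable_funM].
transitivity (\int[lebesgue_measure]_(x in phi @^-1` A) ((EFin \o g) \o phi) x).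
  rewrite /normal_prob; rewrite (_ : [set x | A (t * x)%R] = phi @^-1` A); last first.
    by apply/funext => x; rewrite /preimage/= /phi addr0.
  by apply: eq_integral => x _; rewrite /= /g /phi addr0 mulrC mulKf.
have gE0 x : 0 <= (EFin \o g) x by rewrite lee_fin.
have mgE B : measurable_fun B (EFin \o g).
  by apply/measurable_EFinP; exact: measurable_funTS.
rewrite -(ge0_integral_pushforward mphi)//; [|exact: mgE].
have ti0 : (0 <= t^-1)%R by rewrite invr_ge0 ltW.
transitivity (\int[mscale (NngNum ti0) lebesgue_measure]_(y in A) (EFin \o g) y).
  apply: eq_measure_integral => B mB BA.
  by rewrite /pushforward/= /mscale/= -(lebesgue_measure_affine 0 t0 mB).
transitivity ((t^-1)%:E * \int[lebesgue_measure]_(y in A) (EFin \o g) y).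
  by apply: ge0_integral_mscale; [exact: mA|exact: mgE|move=> x _; exact: gE0].
transitivity (\int[lebesgue_measure]_(y in A) ((t^-1)%:E * (EFin \o g) y)).
  symmetry; apply: ge0_integralZl; [exact: mA|exact: mgE|move=> x _; exact: gE0|].
  by rewrite lee_fin.
apply: eq_integral => x _; rewrite -!EFinM /= /g /scaling_density !normal_pdfE ?oner_eq0//.
congr EFin; rewrite (_ : normal_fun 0 1 (x / t) =
  expR (x ^+ 2 * (1 - t ^- 2) / 2) * normal_fun 0 1 x)%R; first by ring.
by rewrite /normal_fun -expRD; congr expR; field.
Qed.

(** Once the sides other than [j] are fixed, the image of [mu] under coordinate [j] is the constant
    [c] times [nu j], and the weight sees only that image. This is the induction step for product
    densities. *)
Lemma box_density (mu : {measure set (Rvec R n) -> \bar R})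
    (nu : 'I_n -> {measure set (measurableTypeR R) -> \bar R}) (j : 'I_n) (f : R -> R) :
  (forall i B, measurable B -> nu i B \is a fin_num) ->
  (forall A, (forall i, measurable (A i)) ->
     mu (box A) = \prod_(i < n) nu i (A i)) ->
  (forall x, (0 <= f x)%R) -> measurable_fun setT f ->
  forall A, (forall i, measurable (A i)) ->
    \int[mu]_(x in box A) (f ((x : 'cV[R]_n) j 0%R))%:E =
    (\int[nu j]_(x in A j) (f x)%:E) * \prod_(i < n | i != j) nu i (A i).
Proof.
move=> nufin muE f0 mf A mA.
pose D : set (Rvec R n) := box (fun i => if i == j then setT else A i).
have mD : measurable D by apply: measurable_box => i; case: ifP.
pose cj (x : Rvec R n) : measurableTypeR R := (x : 'cV[R]_n) j 0%R.
have mcj : measurable_fun setT cj by exact: measurable_coord.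
pose c := \prod_(i < n | i != j) nu i (A i).
have c0 : 0 <= c by apply: prode_ge0.
have cfin : c \is a fin_num by rewrite /c; apply: prode_fin_num => i _; apply: nufin; exact: mA.
have fc0 : (0 <= fine c)%R by rewrite fine_ge0.
have boxE B : box (fun i => if i == j then B else A i) = D `&` cj @^-1` B.
  apply/seteqP; split => x.
    move=> h; split=> [i|]; last by have := h j; rewrite /= eqxx.
    by have := h i; rewrite /=; case: ifP.
  by move=> [h hj] i; have := h i; rewrite /=; case: ifPn => // /eqP ->.
have -> : box A = D `&` cj @^-1` (A j).
  by rewrite -boxE; congr box; apply/funext => i; case: ifPn => // /eqP ->.
(* The slab [D] is encoded as an indicator density, which turns the integral over the box into one
   over a preimage under [cj]. *)
pose ind : Rvec R n -> R := \1_D.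
have ind0 x : (0 <= ind x)%R by [].
have mind : measurable_fun setT ind by exact: measurable_indic.
pose muD := density_measure mu ind0 mind.
have fE0 x : 0 <= (f x)%:E by rewrite lee_fin.
have mfE B : measurable_fun B (EFin \o f).
  by apply/measurable_EFinP; exact: measurable_funTS.
have -> : \int[mu]_(x in D `&` cj @^-1` A j) (f (cj x))%:E =
          \int[muD]_(x in cj @^-1` A j) ((EFin \o f) \o cj) x.
  have mcA : measurable (cj @^-1` A j) by rewrite -[X in measurable X]setTI;
    apply: (mcj measurableT); exact: mA.
  have mfc : measurable_fun setT ((EFin \o f) \o cj).
    by apply: measurableT_comp; [exact: mfE|exact: mcj].
  rewrite (integral_density_in _ _ _ mcA mfc (fun x => fE0 (cj x))).
  rewrite setIC integral_mkcondr; apply: eq_integral => x _.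
  by rewrite patchE /ind indicE; case: (_ \in D); rewrite ?mule1 ?mule0.
rewrite -(ge0_integral_pushforward mcj); [|exact: (mA j)|exact: mfE|by move=> y _; exact: fE0].
rewrite muleC -/c -(fineK cfin).
transitivity (\int[mscale (NngNum fc0) (nu j)]_(y in A j) (EFin \o f) y); last first.
  by apply: ge0_integral_mscale; [exact: (mA j)|exact: mfE|move=> x _; exact: fE0].
apply: eq_measure_integral => B mB BA.
rewrite [LHS](_ : _ = \int[mu]_(x in cj @^-1` B) (\1_D x)%:E)//.
rewrite /mscale/= integral_indic//; last first.
  by rewrite -[X in measurable X]setTI; exact: mcj.
rewrite -boxE muE; last by move=> i; case: ifP.
rewrite (bigD1 j)//= eqxx muleC; congr (_ * _).
rewrite [RHS]fineK//.
by apply: eq_bigr => i /negbTE ->.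
Qed.

Definition norm2 (x : 'cV[R]_n) : R := (\sum_(i < n) x i 0 ^+ 2)%R.

Section gaussian_scaling.
Variable gamma : probability (Rvec R n) R.
Hypothesis gammaN : std_normal_law gamma.
Variable t : R.
Hypothesis t0 : (0 < t)%R.

Let f := scaling_density t.
Let f0 x : (0 <= f x)%R. Proof. exact: scaling_density_ge0. Qed.
Let mf : measurable_fun setT f. Proof. exact: measurable_scaling_density. Qed.

Let prodf (k : nat) (x : Rvec R n) : R :=
  (\prod_(i < n | (i < k)%N) f ((x : 'cV[R]_n) i 0))%R.

Let prodf_ge0 k x : (0 <= prodf k x)%R. Proof. exact: prodr_ge0. Qed.

Let measurable_prodf k : measurable_fun setT (prodf k).
Proof.
rewrite /prodf; under eq_fun do rewrite big_mkcond.
apply: measurable_prod => i _; case: (i < k)%N => //.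
by apply: measurableT_comp; [exact: mf|exact: measurable_coord].
Qed.

Let N : {measure set (measurableTypeR R) -> \bar R} := @normal_prob R 0 1.
Let Nf : {measure set (measurableTypeR R) -> \bar R} := density_measure N f0 mf.
Let nu k (i : 'I_n) := if (i < k)%N then Nf else N.

Let NfE A : measurable A -> Nf A = N [set x | A (t * x)%R].
Proof. by move=> mA; rewrite /N/= normal_prob_scaling. Qed.

Let nu_fin k i B : measurable B -> nu k i B \is a fin_num.
Proof.
move=> mB; rewrite /nu; case: ifP => _; last exact: fin_num_measure.
rewrite NfE//; apply: fin_num_measure; rewrite -[X in measurable X]setTI.
exact: measurable_funM.
Qed.

Let box_prodf (k : nat) (A : 'I_n -> set R) : (k <= n)%N ->
  (forall i, measurable (A i)) ->
  \int[gamma]_(x in box A) (prodf k x)%:E = \prod_(i < n) nu k i (A i).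
Proof.
elim: k A => [|k IH] A kn mA.
  rewrite /prodf; under eq_integral do rewrite big_pred0//.
  rewrite integral_cst; last exact: measurable_box.
  by rewrite mul1e; exact: gammaN.
pose mu := density_measure gamma (prodf_ge0 k) (measurable_prodf k).
have muE B : (forall i, measurable (B i)) -> mu (box B) = \prod_(i < n) nu k i (B i).
  by move=> mB; apply: IH => //; exact: ltnW.
pose o := Ordinal kn.
have := @box_density mu (nu k) o f (@nu_fin k) muE f0 mf A mA.
rewrite integral_density_in//; last 3 first.
- exact: measurable_box.
- by apply/measurable_EFinP; apply: measurableT_comp; [exact: mf|exact: measurable_coord].
- by move=> x; rewrite lee_fin.
move=> E; rewrite (bigD1 o)//= {1}/nu/= ltnSn.
transitivity (\int[gamma]_(x in box A)
    ((f ((x : 'cV[R]_n) o 0))%:E * (prodf k x)%:E)).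
  apply: eq_integral => x _; rewrite -EFinM; congr EFin.
  rewrite /prodf (bigD1 o)//=; congr (_ * _)%R; apply: eq_bigl => i.
  by rewrite ltnS ltn_neqAle andbC.
rewrite E /nu/= ltnn; congr (_ * _); apply: eq_bigr => i io.
by rewrite ltnS [in RHS]leq_eqVlt -[X in X || _]/(i == o) (negbTE io).
Qed.

Lemma gaussian_scaling (B : set (Rvec R n)) : measurable B ->
  gamma [set x : 'cV[R]_n | B (t *: x)%R] =
  \int[gamma]_(x in B) (t ^- n * expR (norm2 x * (1 - t ^- 2) / 2))%:E.
Proof.
have mt : measurable_fun setT (fun x : Rvec R n => (t *: (x : 'cV[R]_n))%R : Rvec R n).
  apply: measurable_fun_Rvec => i; under eq_fun do rewrite mxE.
  by apply: measurable_funM => //; exact: measurable_coord.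
move=> mB; transitivity (\int[gamma]_(x in B) (prodf n x)%:E); last first.
  apply: eq_integral => x _; congr EFin; rewrite /prodf big_mkcond/=.
  under eq_bigr do rewrite ltn_ord.
  rewrite big_split/= prodr_const card_ord exprVn; congr (_ * _)%R.
  by rewrite -expR_sum /norm2 !mulr_suml.
pose m1 : {measure set (Rvec R n) -> \bar R} :=
  pushforward gamma (fun x : Rvec R n => (t *: (x : 'cV[R]_n))%R : Rvec R n).
pose m2 : {measure set (Rvec R n) -> \bar R} :=
  density_measure gamma (prodf_ge0 n) (measurable_prodf n).
suff : forall C : set (Rvec R n), measurable C -> m1 mt C = m2 C by apply.
apply: Rvec_measure_unique.
  by rewrite /m1/= /pushforward preimage_setT probability_setT ltry.
move=> A mA; rewrite /m2/= [RHS]box_prodf//.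
rewrite [LHS](_ : _ = gamma (box (fun i => [set x | A i (t * x)%R]))); last first.
  rewrite /m1/= /pushforward; congr (gamma _); apply/seteqP.
  by split => x h i; have := h i; rewrite /= mxE.
rewrite [LHS]gammaN; last first.
  move=> i; rewrite -[X in measurable X]setTI; exact: measurable_funM.
apply: eq_bigr => i _; rewrite /nu ltn_ord; symmetry; apply: NfE; exact: mA.
Qed.

End gaussian_scaling.
End product_density.

(** * Power densities on the half-line *)

Section power_density.
Context {R : realType}.
Local Open Scope ereal_scope.
Local Notation lambda := (@lebesgue_measure R).

Lemma ocitv_measure_unique (m1 m2 : {measure set (measurableTypeR R) -> \bar R}) :
  (forall a b, m1 `]a, b]%classic < +oo) ->
  (forall a b, m1 `]a, b]%classic = m2 `]a, b]%classic) ->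
  forall A, measurable A -> m1 A = m2 A.
Proof.
move=> fin1 m12 A mA.
apply: (measure_unique (@ocitv R : set (set (measurableTypeR R)))
  (fun k => `](- k%:R)%R, k%:R]%classic)) => //.
- exact: ocitvI.
- by move=> k; exact: is_ocitv.
- apply/seteqP; split => // x _; exists (Num.bound `|x|)%R => //=.
  have := archi_boundP (normr_ge0 x); rewrite ltr_norml in_itv/= => /andP[-> /ltW].
  by [].
- by move=> _ [[a b] _ <-]; exact: m12.
Qed.

(** Density of the measure giving []a, b]] the mass b^(k+1) - a^(k+1) when 0 <= a <= b: up to a
    constant, the growth of the volume of balls in dimension k+1. *)
Definition power_density (k : nat) (s : R) : R :=
  (k.+1%:R * s ^+ k * \1_(`]0%R, +oo[%classic : set R) s)%R.

Lemma power_density_ge0 k s : (0 <= power_density k s)%R.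
Proof.
rewrite /power_density indicE; have [|_] := boolP (s \in _); last by rewrite mulr0.
by rewrite inE/= in_itv/= andbT => s0; rewrite mulr1 mulr_ge0// exprn_ge0// ltW.
Qed.

Lemma measurable_power_density k : measurable_fun setT (power_density k).
Proof. by apply: measurable_funM => //; apply: measurable_funM. Qed.

Definition power_measure k :=
  density_measure lambda (power_density_ge0 k) (measurable_power_density k).

Lemma integral_power (k : nat) (a b : R) : (0 <= a)%R -> (a <= b)%R ->
  \int[lambda]_(s in `]a, b]) (k.+1%:R * s ^+ k)%:E = (b ^+ k.+1 - a ^+ k.+1)%:E.
Proof.
move=> a0; rewrite le_eqVlt => /predU1P[->|ab].
  by rewrite set_itv_ge ?bnd_simp// integral_set0 subrr.
have cX : continuous (fun s : R => (s ^+ k.+1)%R) by exact: exprn_continuous.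
rewrite integral_itv_obnd_cbnd; last first.
  by apply/measurable_EFinP; apply: measurable_funTS; apply: measurable_funM.
rewrite (@continuous_FTC2 _ _ (fun s => s ^+ k.+1)%R)//.
- apply: continuous_subspaceT => x; apply: cvgM; first exact: cvg_cst.
  exact: exprn_continuous.
- split.
  + by move=> x _; exact: exprn_derivable.
  + by apply: cvg_at_right_filter; exact: cX.
  + by apply: cvg_at_left_filter; exact: cX.
- by move=> x _; exact: exp_derive1.
Qed.

Lemma power_measure_itvoc k (a b : R) : (a <= b)%R ->
  power_measure k `]a, b]%classic =
  ((Num.max b 0) ^+ k.+1 - (Num.max a 0) ^+ k.+1)%:E.
Proof.
move=> ab; rewrite -integral_power; last 2 first.
- by rewrite le_max lexx orbT.
- by rewrite ge_max !le_max ab lexx orbT.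
rewrite [LHS]integral_mkcond [RHS]integral_mkcond; apply: eq_integral => x _.
rewrite !patchE /power_density indicE.
have -> : (x \in `]Num.max a 0%R, Num.max b 0%R]%classic) =
          (x \in `]a, b]%classic) && (x \in `]0%R, +oo[%classic).
  rewrite !mem_setE !in_itv/= gt_max le_max andbT.
  apply/idP/idP; last by case/andP => /andP[-> ->] ->.
  by case/andP => /andP[-> x0]; rewrite x0 [(x <= 0)%R]leNgt x0 orbF => ->.
by case: (x \in _) => //=; case: (x \in _); rewrite ?mulr1 ?mulr0.
Qed.
End power_density.

(** * The Gamma integral and the chi normalisation *)

Section gamma_chi.
Context {R : realType}.
Local Open Scope ereal_scope.
Local Notation lambda := (@lebesgue_measure R).

Lemma integral_power_measure (k : nat) (g : R -> \bar R) :
  measurable_fun setT g -> (forall x, 0 <= g x) ->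
  \int[power_measure k]_x g x =
  \int[lambda]_(x in `]0%R, +oo[) (g x * (k.+1%:R * x ^+ k)%:E).
Proof.
move=> mg g0; rewrite integral_density//.
rewrite [RHS]integral_mkcond; apply: eq_integral => x _.
rewrite patchE /power_density indicE; case: (x \in _); rewrite ?mulr1//.
by rewrite mulr0 mule0.
Qed.

Definition half_sqr (s : measurableTypeR R) : measurableTypeR R := (s ^+ 2 / 2)%R.

Lemma measurable_half_sqr : measurable_fun setT half_sqr.
Proof. by apply: measurable_funM => //; apply: measurable_funX. Qed.

(** The substitution x = s^2 / 2, dx = s ds, as an identity of measures; [power_measure 1] is 2 s
    ds, whence the factor 2. Half-open intervals suffice for the comparison. *)
Lemma half_sqr_power_measure (A : set R) : measurable A ->
  power_measure 1 (half_sqr @^-1` A) = 2%:E * power_measure 0 A.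
Proof.
move=> mA; have ms := measurable_half_sqr.
have two0 : (0 <= 2 :> R)%R by [].
pose m1 : {measure set (measurableTypeR R) -> \bar R} :=
  mscale (NngNum two0) (power_measure 0).
pose m2 : {measure set (measurableTypeR R) -> \bar R} :=
  pushforward (power_measure 1) half_sqr.
suff : forall B, measurable B -> m1 B = m2 ms B by move=> /(_ A mA)/esym.
have m1E (a b : R) : (a <= b)%R ->
    m1 `]a, b]%classic = (2 * (Num.max b 0 - Num.max a 0))%:E.
  move=> ab; rewrite [LHS](_ : _ = 2%:E * power_measure 0 `]a, b]%classic)//.
  by rewrite power_measure_itvoc// !expr1.
have m10 (a b : R) : (b < a)%R -> `]a, b]%classic = set0.
  by move=> ba; rewrite set_itv_ge// bnd_simp -leNgt ltW.
apply: ocitv_measure_unique => a b; have [ab|ba] := leP a b.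
- by rewrite m1E// ltry.
- by rewrite m10// measure0 ltry.
- rewrite m1E//.
  (* Square roots of negative numbers being 0, this interval is the right one for all signs of [a]
     and [b]. *)
  transitivity (power_measure 1 `](Num.sqrt (2 * a)), (Num.sqrt (2 * b))]%classic).
    rewrite power_measure_itvoc ?ler_wsqrtr ?ler_pM2l//.
    have sq (x : R) : (Num.max (Num.sqrt (2 * x)) 0 ^+ 2 = 2 * Num.max x 0)%R.
      rewrite max_l ?sqrtr_ge0//; have [x0|x0] := leP 0%R x.
        by rewrite sqr_sqrtr ?mulr_ge0// max_l.
      by rewrite ler0_sqrtr ?expr0n ?max_r ?mulr0 ?pmulr_rle0// ltW.
    by rewrite !sq mulrBr.
  rewrite /m2/= /pushforward [LHS]integral_mkcond [RHS]integral_mkcond.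
  apply: eq_integral => s _; rewrite !patchE /power_density indicE.
  have [s0|_] := boolP (s \in `]0%R, +oo[%classic); last first.
    by rewrite mulr0; case: ifP; case: ifP.
  congr (if _ then _ else _); move: s0; rewrite !mem_setE !in_itv/= andbT => s0.
  rewrite [RHS](_ : _ = (a < s ^+ 2 / 2 <= b)%R); last first.
    by [].
  congr andb.
    rewrite ltr_pdivlMr// [(a * 2)%R]mulrC; have [a0|a0] := leP 0%R a.
      by rewrite -[in RHS](sqr_sqrtr (_ : 0 <= 2 * a)%R) ?mulr_ge0// ltr_pXn2r// nnegrE
        ?sqrtr_ge0// ltW.
    rewrite ler0_sqrtr ?pmulr_rle0 1?ltW// s0; symmetry.
    by rewrite (lt_le_trans _ (sqr_ge0 _))// pmulr_rlt0.
  rewrite ler_pdivrMr// [(b * 2)%R]mulrC; have [b0|b0] := leP 0%R b.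
    by rewrite -[in RHS](sqr_sqrtr (_ : 0 <= 2 * b)%R) ?mulr_ge0// ler_pXn2r// nnegrE
      ?sqrtr_ge0// ltW.
  rewrite ler0_sqrtr; last by rewrite pmulr_rle0// ltW.
  rewrite leNgt s0; symmetry; apply/negbTE.
  by rewrite -ltNge (lt_le_trans _ (sqr_ge0 _))// pmulr_rlt0.
- by rewrite m10// !measure0.
Qed.

(** The same substitution turns the Gamma integral at n/2 into the radial integral of the Gaussian.
    The identity is in the extended reals, as finiteness is settled only later, by the total mass of
    [gamma]. *)
Lemma gamma_fun_chi (n : nat) : (0 < n)%N ->
  (2 `^ (n%:R / 2 - 1))%:E *
    \int[lambda]_(x in `]0%R, +oo[) (x `^ (n%:R / 2 - 1) * expR (- x))%:E =
  \int[lambda]_(s in `]0%R, +oo[) (s ^+ n.-1 * expR (- (s ^+ 2 / 2)))%:E.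
Proof.
move=> n0; set c : R := (n%:R / 2 - 1)%R.
pose G (x : R) : \bar R := (x `^ c * expR (- x))%:E.
have G0 x : 0 <= G x by rewrite lee_fin mulr_ge0 ?powR_ge0 ?expR_ge0.
have mG : measurable_fun setT G.
  apply/measurable_EFinP; apply: measurable_funM; first exact: measurable_powR.
  exact: measurableT_comp.
have two0 : (0 <= 2 :> R)%R by [].
have E0 : \int[lambda]_(x in `]0%R, +oo[) G x = \int[power_measure 0]_x G x.
  by rewrite integral_power_measure//; apply: eq_integral => x _; rewrite expr0 mulr1 mule1.
have E1 : 2%:E * \int[power_measure 0]_x G x =
    \int[power_measure 1]_s G (half_sqr s).
  transitivity (\int[mscale (NngNum two0) (power_measure 0)]_x G x).
    by symmetry; apply: ge0_integral_mscale.
  transitivity (\int[pushforward (power_measure 1) half_sqr]_x G x).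
    apply: eq_measure_integral => //; first exact: measurable_half_sqr.
    by move=> ? A mA _; symmetry; exact: half_sqr_power_measure.
  by rewrite ge0_integral_pushforward//; exact: measurable_half_sqr.
rewrite [X in _ * X]E0.
have -> : \int[power_measure 0]_x G x =
    (2^-1)%:E * \int[power_measure 1]_s G (half_sqr s).
  by rewrite -E1 muleA -EFinM mulVf// mul1e.
have GhE0 x : 0 <= G (half_sqr x) by exact: G0.
have mGh : measurable_fun setT (G \o half_sqr).
  by apply: measurableT_comp; [exact: mG|exact: measurable_half_sqr].
rewrite muleA integral_power_measure//.
pose h s := G (half_sqr s) * (2%:R * s ^+ 1)%:E.
have mh : measurable_fun (`]0%R, +oo[%classic : set R) h.
  apply: measurable_funTS; apply: emeasurable_funM; first exact: mGh.
  by apply/measurable_EFinP; apply: measurable_funM.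
have h0 x : (`]0%R, +oo[%classic : set R) x -> 0 <= h x.
  rewrite /= in_itv/= andbT => x0.
  by rewrite mule_ge0// lee_fin mulr_ge0// ltW.
transitivity (\int[lambda]_(x in `]0%R, +oo[) ((2 `^ c / 2)%:E * h x)).
  symmetry; rewrite -EFinM; apply: ge0_integralZl.
  - exact: measurable_itv.
  - exact: mh.
  - exact: h0.
  by rewrite lee_fin mulr_ge0 ?powR_ge0.
rewrite /h.
apply: eq_integral => s; rewrite inE/= in_itv/= andbT => s0.
rewrite /G -!EFinM expr1; congr EFin.
have -> : (s ^+ n.-1 = (2 `^ c * half_sqr s `^ c) * s)%R.
  have hs0 : (0 <= half_sqr s)%R by rewrite mulr_ge0// sqr_ge0.
  rewrite -powRM// (_ : 2 * half_sqr s = s ^+ 2)%R; last by rewrite /half_sqr; field.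
  rewrite -[(s ^+ 2)%R]powR_mulrn ?ltW// -powRrM -[X in (_ * X)%R]powRr1 ?ltW//.
  rewrite -powRD; last by rewrite (gt_eqF s0) implybT.
  rewrite -powR_mulrn ?ltW//; congr (_ `^ _)%R.
  by rewrite /c -[in RHS](prednK n0) -natr1; field.
by rewrite /half_sqr; field.
Qed.
End gamma_chi.

(** * The Euclidean norm *)

Section euclidean_norm.
Context {R : realType} {n : nat}.
Implicit Types x : 'cV[R]_n.

Lemma norm2_ge0 x : (0 <= norm2 x)%R.
Proof. by apply: sumr_ge0 => i _; exact: sqr_ge0. Qed.

Lemma enormE x : enorm x = Num.sqrt (norm2 x). Proof. by []. Qed.

Lemma enorm_ge0 x : (0 <= enorm x)%R. Proof. exact: sqrtr_ge0. Qed.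

Lemma enorm_sqr x : (enorm x ^+ 2 = norm2 x)%R.
Proof. by rewrite sqr_sqrtr// norm2_ge0. Qed.

Lemma norm2Z (t : R) x : norm2 (t *: x) = (t ^+ 2 * norm2 x)%R.
Proof.
by rewrite /norm2 mulr_sumr; apply: eq_bigr => i _; rewrite mxE exprMn.
Qed.

Lemma enormZ (t : R) x : enorm (t *: x) = (`|t| * enorm x)%R.
Proof. by rewrite enormE norm2Z sqrtrM ?sqr_ge0// sqrtr_sqr. Qed.

Lemma enorm_eq0 x : enorm x = 0%R -> x = 0%R.
Proof.
move=> /eqP; rewrite sqrtr_eq0 => x0; apply/colP => i; rewrite mxE.
have : norm2 x = 0%R by apply/eqP; rewrite eq_le x0 norm2_ge0.
by move/psumr_eq0P => /(_ (fun i _ => sqr_ge0 _) i isT)/eqP; rewrite sqrf_eq0 => /eqP.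
Qed.

Lemma measurable_norm2 : measurable_fun setT (norm2 : Rvec R n -> R).
Proof.
apply: measurable_sum => i; apply: measurable_funX; exact: measurable_coord.
Qed.

Lemma measurable_enorm :
  measurable_fun setT (@enorm R n : Rvec R n -> measurableTypeR R).
Proof.
apply: measurableT_comp; last exact: measurable_norm2.
by apply: continuous_measurable_fun; exact: sqrt_continuous.
Qed.

End euclidean_norm.

(** * The radial law of the standard Gaussian *)

Section radial_law.
Context {R : realType} {k : nat}.
Local Notation n := k.+1.
Local Open Scope ereal_scope.
Variable gamma : probability (Rvec R n) R.
Hypothesis gammaN : std_normal_law gamma.

Let dens (x : Rvec R n) : R := expR (norm2 x / 2).
Let dens_ge0 x : (0 <= dens x)%R. Proof. exact: expR_ge0. Qed.
Let measurable_dens : measurable_fun setT dens.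
Proof.
apply: measurableT_comp => //; apply: measurable_funM => //.
exact: measurable_norm2.
Qed.

(* e^(|x|^2/2) gamma is, up to a constant, the Lebesgue measure: it is homogeneous of degree n. *)
Let eta := density_measure gamma dens_ge0 measurable_dens.
Let ball_ (r : R) : set (Rvec R n) := [set x | (enorm (x : 'cV[R]_n) <= r)%R].

Let measurable_ball r : measurable (ball_ r).
Proof.
rewrite [X in measurable X](_ : _ = setT `&` (@enorm R n) @^-1` `]-oo, r]%classic).
  by apply: measurable_enorm => //; exact: measurable_itv.
by rewrite setTI; apply/seteqP; split => x; rewrite /ball_/= in_itv/=.
Qed.

(** By [gaussian_scaling] the image of [gamma] under multiplication by t has density t^-n exp(|x|^2
    (1 - t^-2) / 2). The weight of [eta], transported to the ball of radius t, is exp(|x|^2 / (2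
    t^2)), and the product of the two is t^-n exp(|x|^2 / 2). *)
Let eta_scaling (t : R) : (0 < t)%R ->
  eta (ball_ t) = (t ^+ n)%:E * eta (ball_ 1).
Proof.
move=> t0; have tN0 : t != 0%R by rewrite gt_eqF.
pose w (x : Rvec R n) : R := (t ^- n * expR (norm2 x * (1 - t ^- 2) / 2))%R.
have w0 x : (0 <= w x)%R by rewrite mulr_ge0 ?expR_ge0// invr_ge0 exprn_ge0// ltW.
have mw : measurable_fun setT w.
  apply: measurable_funM => //; apply: measurableT_comp => //.
  by apply: measurable_funM => //; apply: measurable_funM => //; exact: measurable_norm2.
pose phi (x : Rvec R n) : Rvec R n := (t *: (x : 'cV[R]_n))%R.
have mphi : measurable_fun setT phi.
  apply: measurable_fun_Rvec => i; rewrite /phi; under eq_fun do rewrite mxE.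
  by apply: measurable_funM => //; exact: measurable_coord.
pose g (x : Rvec R n) : \bar R := (expR (norm2 x / t ^+ 2 / 2))%:E.
have g0 x : 0 <= g x by rewrite lee_fin expR_ge0.
have mg : measurable_fun setT g.
  apply/measurable_EFinP; apply: measurableT_comp => //.
  by apply: measurable_funM => //; apply: measurable_funM => //; exact: measurable_norm2.
have E : eta (ball_ 1) = \int[density_measure gamma w0 mw]_(x in ball_ t) g x.
  transitivity (\int[pushforward gamma phi]_(x in ball_ t) g x); last first.
    by apply: eq_measure_integral => // A mA _; exact: gaussian_scaling.
  rewrite ge0_integral_pushforward//; last exact: measurable_funTS.
  rewrite (_ : phi @^-1` ball_ t = ball_ 1); last first.
    apply/seteqP; split => x; rewrite /ball_/phi/= enormZ gtr0_norm//.
      by rewrite -ler_pdivlMl// mulVf.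
    by rewrite -ler_pdivlMl// mulVf.
  by apply: eq_integral => x _;
    rewrite /= /g /phi norm2Z /dens [(t ^+ 2 * _)%R]mulrC mulfK// expf_neq0.
rewrite E integral_density_in//.
have mgw : measurable_fun (ball_ t) (fun x => g x * (w x)%:E).
  by apply: measurable_funTS; apply: emeasurable_funM => //; exact/measurable_EFinP.
rewrite -ge0_integralZl//; last 2 first.
- by move=> x _; rewrite mule_ge0// lee_fin.
- by rewrite lee_fin exprn_ge0// ltW.
apply: eq_integral => x _; rewrite -!EFinM; congr EFin.
have -> : dens x = (expR (norm2 x / t ^+ 2 / 2) * expR (norm2 x * (1 - t ^- 2) / 2))%R.
  by rewrite -expRD; congr expR; field; rewrite tN0.
by rewrite /w; field; rewrite expf_neq0.
Qed.

Let eta_ball0 : eta (ball_ 0) = 0.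
Proof.
have -> : ball_ 0 = box (fun=> [set 0%R]).
  apply/seteqP; split => x; rewrite /ball_/= => h.
    have /enorm_eq0 -> : enorm x = 0%R by apply/eqP; rewrite eq_le h enorm_ge0.
    by move=> i; rewrite mxE.
  by rewrite enormE /norm2 big1 ?sqrtr0// => i _; rewrite (h i) expr0n.
have g0 : gamma (box (fun=> [set 0%R])) = 0.
  rewrite [LHS]gammaN// big_ord_recl [X in X * _](_ : _ = 0) ?mul0e//.
  exact: integral_set1.
transitivity (\int[gamma]_(x in box (fun=> [set 0%R])) 1).
  apply: eq_integral => x; rewrite inE => x0; congr EFin; rewrite /dens.
  by rewrite /norm2 big1 ?mul0r ?expR0// => i _; rewrite (x0 i) expr0n.
by rewrite integral_cst; [rewrite mul1e|apply: measurable_box].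
Qed.

Let eta_ball1_fin : eta (ball_ 1) \is a fin_num.
Proof.
rewrite ge0_fin_numE ?measure_ge0//.
apply: (@le_lt_trans _ _ (\int[gamma]_(x in ball_ 1) (expR 1)%:E)).
  apply: ge0_le_integral => //.
  - by move=> x _; rewrite lee_fin.
  - by apply/measurable_EFinP; exact: measurable_funTS.
  - move=> x; rewrite /ball_/= => x1; rewrite lee_fin ler_expR -enorm_sqr.
    by have := enorm_ge0 x; nra.
by rewrite integral_cst// lte_mul_pinfty ?lee_fin ?expR_ge0// -ge0_fin_numE
  ?measure_ge0// fin_num_measure.
Qed.

Let c1 : R := fine (eta (ball_ 1)).

Let eta_ball r : eta (ball_ r) = (c1 * Num.max r 0 ^+ n)%:E.
Proof.
have [r0|r0] := leP r 0%R; last first.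
  by rewrite eta_scaling// muleC EFinM /c1 fineK.
rewrite expr0n mulr0; apply/eqP; rewrite eq_le measure_ge0 andbT.
apply: (@le_trans _ _ (eta (ball_ 0))); last by rewrite eta_ball0.
by apply: le_measure; rewrite ?inE// => x; rewrite /ball_/= => /le_trans; apply.
Qed.

Let nu : {measure set (measurableTypeR R) -> \bar R}.
Proof.
refine (pushforward eta (@enorm R n : Rvec R n -> measurableTypeR R)).
exact: measurable_enorm.
Defined.

Let nu_ray r : nu `]-oo, r]%classic = (c1 * Num.max r 0 ^+ n)%:E.
Proof.
by rewrite -eta_ball.
Qed.

Let c1_ge0 : (0 <= c1)%R. Proof. by rewrite fine_ge0// measure_ge0. Qed.

(** Homogeneity fixes the masses of balls, hence those of the half-lines []-oo, r]]; these are
    finite, and subtraction gives the half-open intervals. *)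
Let nuE A : measurable A -> nu A = c1%:E * power_measure k A.
Proof.
suff : forall A, measurable A -> nu A = mscale (NngNum c1_ge0) (power_measure k) A.
  by move=> h /h.
have m10 (m : {measure set (measurableTypeR R) -> \bar R}) (a b : R) :
    (b < a)%R -> m `]a, b]%classic = 0.
  by move=> ba; rewrite set_itv_ge ?measure0// bnd_simp -leNgt ltW.
have nuab (a b : R) : (a <= b)%R ->
    nu `]a, b]%classic = (c1 * (Num.max b 0 ^+ n - Num.max a 0 ^+ n))%:E.
  move=> ab; have : nu `]-oo, b]%classic = nu `]-oo, a]%classic + nu `]a, b]%classic.
    rewrite -measureU//; last first.
      by apply/seteqP; split => // x []/=; rewrite !in_itv/= => xa /andP[/lt_geF]; rewrite xa.
    congr (nu _); apply/seteqP; split => x /=; rewrite !in_itv/=.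
      by move=> ->; case: (leP x a); [left|right].
    by case=> [/le_trans|/andP[]//]; apply.
  rewrite !nu_ray; case: (nu `]a, b]%classic) => [r| |] //.
  by rewrite -EFinD => -[] h; congr EFin; rewrite mulrBr h addrC addKr.
apply: ocitv_measure_unique => a b; have [ab|ba] := leP a b.
- by rewrite nuab// ltry.
- by rewrite m10.
- by rewrite nuab//= /mscale [RHS](_ : _ = c1%:E * power_measure k `]a,
    b]%classic)// power_measure_itvoc.
- by rewrite !m10.
Qed.

Let chi_weight (s : R) : R := (s ^+ k * expR (- (s ^+ 2 / 2)))%R.

Let measurable_chi_weight : measurable_fun setT chi_weight.
Proof.
apply: measurable_funM => //; apply: measurableT_comp => //.
by apply: measurableT_comp => //; apply: measurable_funM => //; apply: measurable_funX.
Qed.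

(** The weight of [eta] is undone by exp(- s^2 / 2) at s = |x|, a function of the norm, so the
    integral passes to the image measure [nu]. *)
Let gamma_enorm (D : set (measurableTypeR R)) : measurable D ->
  gamma [set x : 'cV[R]_n | D (enorm x)] =
  (c1 * n%:R)%:E * \int[lebesgue_measure]_(s in D `&` `]0%R, +oo[) (chi_weight s)%:E.
Proof.
move=> mD; pose h (s : measurableTypeR R) : \bar R := (expR (- (s ^+ 2 / 2)))%:E.
have h0 s : 0 <= h s by rewrite lee_fin expR_ge0.
have mh : measurable_fun setT h.
  apply/measurable_EFinP; apply: measurableT_comp => //.
  by apply: measurableT_comp => //; apply: measurable_funM => //; apply: measurable_funX.
have menorm := @measurable_enorm R n.
have mA : measurable ((@enorm R n : Rvec R n -> measurableTypeR R) @^-1` D).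
  by rewrite -[X in measurable X]setTI; exact: menorm.
transitivity (\int[eta]_(x in (@enorm R n : Rvec R n -> measurableTypeR R) @^-1` D)
    (h \o (@enorm R n : Rvec R n -> measurableTypeR R)) x).
  have mhe : measurable_fun setT (h \o (@enorm R n : Rvec R n -> measurableTypeR R)).
    by apply: measurableT_comp; [exact: mh|exact: menorm].
  rewrite (integral_density_in _ _ _ mA mhe (fun x => h0 (enorm x))).
  transitivity (\int[gamma]_(x in (@enorm R n : Rvec R n -> measurableTypeR R) @^-1` D) 1).
    by rewrite integral_cst// mul1e.
  apply: eq_integral => x _; rewrite /= /h -EFinM; congr EFin.
  by rewrite enorm_sqr /dens -expRD addNr expR0.
transitivity (\int[nu]_(s in D) h s).
  symmetry; apply: ge0_integral_pushforward; [exact: menorm|exact: mD|exact: measurable_funTS|].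
  by move=> s _; exact: h0.
transitivity (\int[mscale (NngNum c1_ge0) (power_measure k)]_(s in D) h s).
  by apply: eq_measure_integral => A mA' _; exact: nuE.
transitivity (c1%:E * \int[power_measure k]_(s in D) h s).
  by apply: ge0_integral_mscale => //; exact: measurable_funTS.
rewrite EFinM -muleA; congr (_ * _).
rewrite (integral_density_in _ _ _ mD mh h0).
transitivity (\int[lebesgue_measure]_(s in D `&` `]0%R, +oo[) (n%:R%:E * (chi_weight s)%:E)).
  rewrite integral_mkcondr; apply: eq_integral => s _; rewrite patchE /power_density indicE.
  case: (s \in _); rewrite ?mulr1 ?mulr0 ?mule0// /h /chi_weight -!EFinM.
  by congr EFin; ring.
have mDp : measurable (D `&` (`]0%R, +oo[%classic : set (measurableTypeR R))).
  by apply: measurableI => //; exact: measurable_itv.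
apply: ge0_integralZl; [exact: mDp| |move=> s [_]|by []].
  by apply/measurable_EFinP; apply: measurable_funTS; exact: measurable_chi_weight.
by rewrite /= in_itv/= andbT => s0; rewrite lee_fin mulr_ge0 ?expR_ge0// exprn_ge0// ltW.
Qed.

Let chi_mass := \int[lebesgue_measure]_(s in `]0%R, +oo[) (chi_weight s)%:E.

Let chi_massE : (c1 * n%:R)%:E * chi_mass = 1.
Proof.
by have := gamma_enorm measurableT; rewrite setTI => <-; exact: probability_setT.
Qed.

(** The total mass 1 of [gamma] determines [c1], so no volume of a ball is computed. [gamma_fun] is
    a real-valued integral, equal to 0 by default if [J] were infinite; that case is excluded
    because the total mass could not be 1. *)
Let chi_mass_const : (c1 * n%:R)%:E = (2 `^ (n%:R / 2 - 1) * gamma_fun (n%:R / 2))^-1%:E.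
Proof.
have := @gamma_fun_chi R n isT; rewrite -/chi_mass /gamma_fun /Rintegral.
set J := \int[lebesgue_measure]_(x in _) _.
have J0 : 0 <= J.
  by apply: integral_ge0 => x _; rewrite lee_fin mulr_ge0 ?powR_ge0 ?expR_ge0.
have p0 : (0 < 2 `^ (n%:R / 2 - 1) :> R)%R by rewrite powR_gt0.
move: chi_massE J0 => + + E; rewrite -E; case: J {E} => [r| |] //= + _.
  rewrite -!EFinM => -[] h; congr EFin.
  have u : (2 `^ (n%:R / 2 - 1) * r != 0)%R.
    by apply: contra_eq_neq h => ->; rewrite mulr0 eq_sym oner_eq0.
  by apply: (mulIf u); rewrite mulVf// h.
rewrite gt0_muley ?lte_fin//; have [->|c0] := eqVneq (c1 * n%:R)%R 0%R.
  by rewrite mul0e => -[] /esym/eqP; rewrite oner_eq0.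
by rewrite gt0_muley// lte_fin lt0r c0 mulr_ge0.
Qed.

Lemma chi_cdf_enorm (r : R) : (0 <= r)%R ->
  (chi_cdf n r%:E)%:E = gamma [set x : 'cV[R]_n | (enorm x <= r)%R].
Proof.
move=> r0; have mD : measurable (`]-oo, r]%classic : set (measurableTypeR R)).
  exact: measurable_itv.
have -> : [set x : 'cV[R]_n | (enorm x <= r)%R] =
    [set x | (`]-oo, r]%classic : set (measurableTypeR R)) (enorm x)].
  by apply/funext => x; rewrite /= in_itv.
have gfin := fin_num_measure gamma _ (measurable_ball r).
rewrite -[RHS]fineK; last exact: gfin.
congr EFin; rewrite gamma_enorm// chi_mass_const /chi_cdf /Rintegral; congr fine.
transitivity (\int[lebesgue_measure]_(s in `]0%R, r]) (chi_pdf n s)%:E).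
  rewrite integral_itv_obnd_cbnd//; apply/measurable_EFinP; apply: measurable_funTS.
  by apply: measurable_funM => //; exact: measurable_chi_weight.
rewrite (_ : `]-oo, r] `&` `]0%R, +oo[ = `]0%R, r])%classic; last first.
  apply/seteqP; split => s /=; rewrite !in_itv/= andbT; first by case=> -> ->.
  by case/andP.
have mrd : measurable (`]0%R, r]%classic : set (measurableTypeR R)) by exact: measurable_itv.
transitivity (\int[lebesgue_measure]_(s in `]0%R, r])
   ((2 `^ (n%:R / 2 - 1) * gamma_fun (n%:R / 2))^-1%:E * (chi_weight s)%:E)).
  by apply: eq_integral => s _; rewrite -EFinM mulrC.
apply: ge0_integralZl; [exact: mrd| |move=> s /=|].
- by apply/measurable_EFinP; apply: measurable_funTS; exact: measurable_chi_weight.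
- rewrite in_itv/= => /andP[s0 _].
  by rewrite lee_fin mulr_ge0 ?expR_ge0// exprn_ge0// ltW.
- by rewrite -chi_mass_const lee_fin mulr_ge0.
Qed.

Lemma gamma_enorm_eq0 : gamma [set x : 'cV[R]_n | enorm x = 0%R] = 0.
Proof.
rewrite (_ : [set x : 'cV[R]_n | enorm x = 0%R] = [set x | (enorm x <= 0)%R]); last first.
  apply/funext => x; apply/propext; split => /= [->//|x0].
  by apply/eqP; rewrite eq_le x0 enorm_ge0.
by rewrite -chi_cdf_enorm//= set_itv1 Rintegral_set1.
Qed.

End radial_law.

(** * Rotation invariance of the plane Gaussian *)

(** The product measure integrates the sections over the first variable by definition; Tonelli gives
    the other order. *)
Lemma product_measure_ysection d1 d2 (T1 : measurableType d1)
    (T2 : measurableType d2) (R : realType)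
    (m1 : {sigma_finite_measure set T1 -> \bar R})
    (m2 : {sigma_finite_measure set T2 -> \bar R}) (E : set (T1 * T2)) :
  measurable E -> (m1 \x m2)%E E = (\int[m2]_y m1 (ysection E y))%E.
Proof.
move=> mE; have := indic_fubini_tonelli m1 m2 mE.
by rewrite indic_fubini_tonelli_FE// indic_fubini_tonelli_GE.
Qed.

Section plane_rotation.
Context {R : realType}.
Local Open Scope ereal_scope.
Local Notation Rm := (measurableTypeR R).
Local Notation lambda := (@lebesgue_measure R).
Local Notation N := (@normal_prob R 0 1).
Implicit Types E : set (Rm * Rm).

(** Each section over a fixed first coordinate is merely translated. *)
Lemma lebesgue_shear_snd (b : R) E : measurable E ->
  (lambda \x lambda) [set p : Rm * Rm | E (p.1, p.2 + b * p.1)%R] =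
  (lambda \x lambda) E.
Proof.
move=> mE; apply: eq_integral => x _ /=.
rewrite -[RHS](lebesgue_measure_translation (b * x)); last exact: measurable_xsection.
by congr (lambda _); apply/seteqP; split => y; rewrite /xsection/= !inE.
Qed.

Lemma lebesgue_shear_fst (a : R) E : measurable E ->
  (lambda \x lambda) [set p : Rm * Rm | E (p.1 + a * p.2, p.2)%R] =
  (lambda \x lambda) E.
Proof.
move=> mE; have mS : measurable [set p : Rm * Rm | E (p.1 + a * p.2, p.2)%R].
  rewrite -[X in measurable X]setTI.
  have mf : measurable_fun setT (fun p : Rm * Rm => (p.1 + a * p.2, p.2)%R : Rm * Rm).
    by apply: measurable_fun_pair => //; apply: measurable_funD => //; apply: measurable_funM.
  exact: mf.
rewrite !product_measure_ysection//.
apply: eq_integral => y _ /=.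
rewrite -[RHS](lebesgue_measure_translation (a * y)); last exact: measurable_ysection.
by congr (lambda _); apply/seteqP; split => x; rewrite /ysection/= !inE.
Qed.

Variables c s : R.
Hypotheses (c0 : (0 <= c)%R) (cs1 : (c ^+ 2 + s ^+ 2 = 1)%R).

Definition rot (p : Rm * Rm) : Rm * Rm :=
  (c * p.1 + s * p.2, - s * p.1 + c * p.2)%R.

Lemma measurable_rot : measurable_fun setT rot.
Proof.
by apply: measurable_fun_pair; apply: measurable_funD => //; apply: measurable_funM.
Qed.

(* A rotation by less than a half-turn is the product of three shears. *)
Lemma lebesgue_rot E : measurable E ->
  (lambda \x lambda) (rot @^-1` E) = (lambda \x lambda) E.
Proof.
(* The tangent of half the angle, so that a s = 1 - c and a (1 + c) = s; the denominator is nonzero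
   because c >= 0. *)
move=> mE; pose a := (s / (1 + c))%R.
have c1 : (1 + c != 0)%R by rewrite gt_eqF// ltr_pwDl.
pose E1 := [set p : Rm * Rm | E (p.1 + a * p.2, p.2)%R].
pose E2 := [set p : Rm * Rm | E1 (p.1, p.2 + - s * p.1)%R].
have mE1 : measurable E1.
  rewrite -[X in measurable X]setTI.
  have mf : measurable_fun setT (fun p : Rm * Rm => (p.1 + a * p.2, p.2)%R : Rm * Rm).
    by apply: measurable_fun_pair => //; apply: measurable_funD => //; apply: measurable_funM.
  exact: mf.
have mE2 : measurable E2.
  rewrite -[X in measurable X]setTI.
  have mf : measurable_fun setT (fun p : Rm * Rm => (p.1, p.2 + - s * p.1)%R : Rm * Rm).
    by apply: measurable_fun_pair => //; apply: measurable_funD => //; apply: measurable_funM.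
  exact: mf.
rewrite -(lebesgue_shear_fst a mE) -(lebesgue_shear_snd (- s) mE1).
rewrite -(lebesgue_shear_fst a mE2); congr ((_ \x _) _).
apply/funext => p; rewrite /preimage/= /E2 /E1/= /rot/=; congr E.
have as1 : (a * s = 1 - c)%R.
  rewrite /a mulrAC; apply: (mulIf c1); rewrite divfK//.
  by rewrite -expr2 -[(s ^+ 2)%R](addKr (c ^+ 2)%R) cs1; ring.
have asc : (a * (1 + c) = s)%R by rewrite /a divfK.
move: {+}as1 {+}asc; move: (a) => b bs bc; case: p => x y /=; congr pair.
  rewrite (_ : x + _ + _ = x - x * (b * s) + b * y + b * y - y * b * (b * s))%R; last by ring.
  by rewrite bs -bc; ring.
by rewrite (_ : y + _ = - s * x + y - y * (b * s))%R; [rewrite bs|]; ring.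
Qed.


Let Phi (p : Rm * Rm) : \bar R := (normal_pdf 0 1 p.1 * normal_pdf 0 1 p.2)%:E.

Let Phi_ge0 p : 0 <= Phi p.
Proof. by rewrite lee_fin mulr_ge0 ?normal_pdf_ge0. Qed.

Let measurable_Phi : measurable_fun setT Phi.
Proof.
apply/measurable_EFinP; apply: measurable_funM.
- by apply: measurableT_comp; [exact: measurable_normal_pdf|exact: measurable_fst].
- by apply: measurableT_comp; [exact: measurable_normal_pdf|exact: measurable_snd].
Qed.

Let normal2E E : measurable E ->
  (N \x N) E = \int[lambda \x lambda]_(p in E) Phi p.
Proof.
move=> mE; rewrite [LHS]integral_normal_prob//; last exact: measurable_fun_xsection.
have mPhiE : measurable_fun setT (Phi \_ E).
  by apply/(measurable_restrictT _ _).1 => //; exact: measurable_funTS.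
rewrite [RHS]integral_mkcond fubini_tonelli1//; last first.
  by move=> p; apply: erestrict_ge0 => ? _; exact: Phi_ge0.
apply: eq_integral => x _; rewrite /fubini_F muleC.
transitivity (\int[lambda]_(y in xsection E x) ((normal_pdf 0 1 x)%:E * (normal_pdf 0 1 y)%:E)).
  symmetry; apply: ge0_integralZl.
  - exact: measurable_xsection.
  - apply: measurable_funTS; apply/measurable_EFinP; exact: measurable_normal_pdf.
  - by move=> y _; rewrite lee_fin normal_pdf_ge0.
  - by rewrite lee_fin normal_pdf_ge0.
rewrite [LHS]integral_mkcond; apply: eq_integral => y _.
by rewrite !patchE mem_xsection.
Qed.

(** The density [Phi] depends only on x^2 + y^2, and [rot] preserves area. *)
Lemma normal2_rot E : measurable E -> (N \x N) (rot @^-1` E) = (N \x N) E.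
Proof.
move=> mE; have mr := measurable_rot.
have mrE : measurable (rot @^-1` E) by rewrite -[X in measurable X]setTI; exact: mr.
rewrite !normal2E//.
transitivity (\int[lambda \x lambda]_(p in rot @^-1` E) (Phi \o rot) p).
  apply: eq_integral => -[x y] _; rewrite /Phi/= !normal_pdfE ?oner_eq0//.
  congr EFin; rewrite /normal_fun mulrACA [in RHS]mulrACA -!expRD.
  congr (_ * expR _)%R; rewrite !subr0 expr1n.
  have xy : (x ^+ 2 + y ^+ 2 = (c * x + s * y) ^+ 2 + (- s * x + c * y) ^+ 2)%R.
    by rewrite -[LHS]mul1r -cs1; ring.
  by transitivity (- (x ^+ 2 + y ^+ 2) / 2)%R; [field|rewrite xy; field].
transitivity (\int[pushforward (lambda \x lambda) rot]_(p in E) Phi p).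
  symmetry; apply: ge0_integral_pushforward; [exact: mr|exact: mE| |by move=> p _].
  exact: measurable_funTS.
by apply: eq_measure_integral => A mA _; exact: lebesgue_rot.
Qed.

End plane_rotation.

(** * Givens rotations *)

Section givens.
Context {R : realType} {n : nat}.
Variables i j : 'I_n.
Hypothesis ij : i != j.

(** The identity matrix corrected at the four entries indexed by [i] and [j], where it acts as
    [rot c s]; Kronecker deltas let products collapse by [sum_delta]. *)
Definition givens (c s : R) : 'M[R]_n := \matrix_(a, b)
  ((b == a)%:R + (c - 1) * (a == i)%:R * (b == i)%:R +
   (c - 1) * (a == j)%:R * (b == j)%:R +
   s * (a == i)%:R * (b == j)%:R - s * (a == j)%:R * (b == i)%:R).

Let sum_delta (l : 'I_n) (f : 'I_n -> R) : \sum_a (a == l)%:R * f a = f l.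
Proof.
rewrite (bigD1 l)//= eqxx mul1r big1 ?addr0// => a /negbTE ->.
by rewrite mul0r.
Qed.

Lemma givens_mulmx m (X : 'M[R]_(n, m)) c s a b : (givens c s *m X) a b =
  if a == i then c * X i b + s * X j b
  else if a == j then - s * X i b + c * X j b else X a b.
Proof.
rewrite !mxE; under eq_bigr do rewrite mxE mulrBl !mulrDl -!mulrA.
rewrite sumrB !big_split/= -!mulr_sumr !(sum_delta _ (X^~ b)).
have [->|_] := eqVneq a i; first by rewrite (negbTE ij) mulr1n mulr0n; ring.
by have [->|_] := eqVneq a j; rewrite ?mulr1n mulr0n; ring.
Qed.

Lemma givens_tr c s : (givens c s)^T = givens c (- s).
Proof. by apply/matrixP => a b; rewrite !mxE (eq_sym a b); ring. Qed.

Lemma givens_orthogonal c s : c ^+ 2 + s ^+ 2 = 1 ->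
  (givens c s)^T *m givens c s = 1%:M.
Proof.
move=> cs; rewrite givens_tr; apply/matrixP => a b; rewrite givens_mulmx.
rewrite !mxE !eqxx (eq_sym j i) (negbTE ij) mulr1n mulr0n.
have [->|_] := eqVneq a i.
  rewrite (eq_sym i b); transitivity ((c ^+ 2 + s ^+ 2) * (b == i)%:R); first by ring.
  by rewrite cs mul1r.
have [->|_] := eqVneq a j.
  rewrite (eq_sym j b); transitivity ((c ^+ 2 + s ^+ 2) * (b == j)%:R); first by ring.
  by rewrite cs mul1r.
by rewrite (eq_sym a b) mulr0n; ring.
Qed.

Lemma measurable_mulmx (A : 'M[R]_n) :
  measurable_fun setT (fun x : Rvec R n => A *m (x : 'cV[R]_n) : Rvec R n).
Proof.
apply: measurable_fun_Rvec => a; under eq_fun do rewrite mxE.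
apply: measurable_sum => b; apply: measurable_funM => //.
exact: measurable_coord.
Qed.

Local Open Scope ereal_scope.
Local Notation Rm := (measurableTypeR R).
Local Notation N := (@normal_prob R 0 1).
Variable gamma : probability (Rvec R n) R.
Hypothesis gammaN : std_normal_law gamma.

(** The preimage of a box is in general not a box, so the product formula does not apply to it. With
    the coordinates other than [i] and [j] confined to their sides, the joint law of the remaining
    two is [C] times the plane Gaussian, whose rotation invariance gives the claim. *)
Lemma gaussian_givens c s : (0 <= c)%R -> (c ^+ 2 + s ^+ 2 = 1)%R ->
  forall B : set (Rvec R n), measurable B ->
  gamma [set x : 'cV[R]_n | B (givens c s *m x)] = gamma B.
Proof.
move=> c0 cs1.
pose m1 : {measure set (Rvec R n) -> \bar R} :=
  pushforward gamma (fun x : Rvec R n => givens c s *m (x : 'cV[R]_n) : Rvec R n).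
have mm := measurable_mulmx (givens c s).
suff : forall B : set (Rvec R n), measurable B -> m1 mm B = gamma B by apply.
apply: Rvec_measure_unique.
  by rewrite [X in X < _](_ : _ = gamma setT)// probability_setT ltry.
move=> A mA; pose D : set (Rvec R n) :=
  box (fun l => if (l == i) || (l == j) then setT else A l).
have mD : measurable D by apply: measurable_box => l; case: ifP.
pose pr (x : Rvec R n) : Rm * Rm := ((x : 'cV[R]_n) i 0%R, (x : 'cV[R]_n) j 0%R).
have mpr : measurable_fun setT pr.
  by apply: measurable_fun_pair; exact: measurable_coord.
pose kappa_ : {measure set (Rm * Rm) -> \bar R} := pushforward (mrestr gamma mD) pr.
pose kappa := kappa_ mpr.
pose C := \prod_(l < n | (l != i) && (l != j)) N (A l).
have C0 : 0 <= C by apply: prode_ge0.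
have Cfin : C \is a fin_num.
  by apply: prode_fin_num => l _; apply: fin_num_measure; exact: mA.
have fC0 : (0 <= fine C)%R by rewrite fine_ge0.
have kappaE B1 B2 : measurable B1 -> measurable B2 ->
    kappa (B1 `*` B2) = C * (N B1 * N B2).
  move=> mB1 mB2; pose A' l := if l == i then B1 else if l == j then B2 else A l.
  transitivity (gamma (box A')).
    congr (gamma _); apply/seteqP; split => x.
      move=> [[/= x1 x2] Dx] l; rewrite /A'; have := Dx l => /=.
      case: eqVneq => [->//|li]; case: eqVneq => [->//|lj]/=.
      by [].
    move=> h; split; first by split; [have := h i|have := h j];
      rewrite /A'/= ?eqxx ?(eq_sym j) ?(negbTE ij).
    by move=> l; have := h l; rewrite /A'/=; case: eqVneq => //= _; case: eqVneq.
  rewrite [LHS]gammaN; last first.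
    by move=> l; rewrite /A'; case: ifP => _; [exact: mB1|case: ifP => _; [exact: mB2|exact: mA]].
  rewrite (bigD1 i)//= (bigD1 j)//=; last by rewrite eq_sym.
  rewrite /A' !eqxx (eq_sym j) (negbTE ij) muleA muleC; congr (_ * _).
  by apply: eq_bigr => l /andP[/negbTE -> /negbTE ->].
have kappa_prod (E : set (Rm * Rm)) : measurable E -> kappa E = C * (N \x N) E.
  suff : forall E : set (Rm * Rm), measurable E ->
      kappa E = mscale (NngNum fC0) (N \x N) E.
    by move=> h /h ->; rewrite -[in RHS](fineK Cfin).
  apply: (measure_unique [set A1 `*` A2 | A1 in measurable & A2 in measurable]
    (fun=> setT)).
  - exact: measurable_prod_measurableType.
  - move=> _ _ [X1 mX1 [X2 mX2 <-]] [Y1 mY1 [Y2 mY2 <-]]; rewrite -setXI.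
    exists (X1 `&` Y1); first exact: measurableI.
    by exists (X2 `&` Y2) => //; exact: measurableI.
  - by move=> _; exists setT => //; exists setT => //; rewrite setXTT.
  - by rewrite bigcup_const//; exists 0%N.
  - move=> _ [X1 mX1 [X2 mX2 <-]]; rewrite kappaE// -product_measure1E//.
    by rewrite -[in LHS](fineK Cfin).
  - move=> _; rewrite -setXTT kappaE// ltey_eq fin_numM// fin_numM//;
    by rewrite fin_num_measure.
transitivity (kappa (rot c s @^-1` (A i `*` A j))).
  congr (gamma _); apply/seteqP; split => x.
    move=> h; split.
      have := h i; have := h j; rewrite /= !givens_mulmx !eqxx (eq_sym j) (negbTE ij).
      by [].
    move=> l; have := h l; rewrite givens_mulmx.
    by case: eqVneq => //= _; case: eqVneq.
  move=> [[/= xi xj] Dx] l; rewrite givens_mulmx; have := Dx l => /=.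
  by case: eqVneq => [->//|li]; case: eqVneq => [->//|lj].
rewrite kappa_prod; last first.
  rewrite -[X in measurable X]setTI; apply: measurable_rot => //.
  by apply: measurableX; exact: mA.
rewrite normal2_rot//; last by apply: measurableX; exact: mA.
rewrite -kappa_prod; last by apply: measurableX; exact: mA.
congr (gamma _); apply/seteqP; split => x.
  move=> [[/= xi xj] Dx] l; have := Dx l => /=.
  by case: eqVneq => [->//|li]; case: eqVneq => [->//|lj].
move=> h; split; first by split; exact: h.
by move=> l; have := h l => /=; case: ifP.
Qed.

(** Givens rotations with nonnegative cosine may bring a unit vector to the negative of the first
    basis vector; the point reflection then corrects the sign. *)
Lemma gaussian_opp (B : set (Rvec R n)) : measurable B ->
  gamma [set x : 'cV[R]_n | B ((- 1)%:M *m x)] = gamma B.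
Proof.
pose m1 : {measure set (Rvec R n) -> \bar R} :=
  pushforward gamma (fun x : Rvec R n => (- 1)%:M *m (x : 'cV[R]_n) : Rvec R n).
have mm := measurable_mulmx (- 1)%:M.
move: B; suff : forall B : set (Rvec R n), measurable B -> m1 mm B = gamma B by apply.
apply: Rvec_measure_unique.
  by rewrite [X in X < _](_ : _ = gamma setT)// probability_setT ltry.
move=> A mA; rewrite [RHS]gammaN//.
transitivity (gamma (box (fun l => [set t | A l (- t)%R]))).
  congr (gamma _); apply/seteqP; split => x h l; have := h l;
    by rewrite /= mul_scalar_mx mxE mulN1r.
have mopp (X : set Rm) : measurable X -> measurable [set t : Rm | X (- t)%R].
  by move=> mX; rewrite -[Y in measurable Y]setTI; exact: oppr_measurable.
rewrite [LHS]gammaN; last by move=> l; apply: mopp; exact: mA.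
apply: eq_bigr => l _; rewrite /normal_prob.
transitivity (\int[lebesgue_measure]_(t in (-%R : Rm -> Rm) @^-1` A l)
    ((fun t : Rm => (normal_pdf 0 1 t)%:E) \o (-%R : Rm -> Rm)) t).
  apply: eq_integral => t _ /=; rewrite !normal_pdfE ?oner_eq0//.
  by rewrite /normal_fun !subr0 sqrrN.
transitivity (\int[pushforward lebesgue_measure (-%R : Rm -> Rm)]_(t in A l) (normal_pdf 0 1 t)%:E).
  symmetry; apply: ge0_integral_pushforward; [exact: oppr_measurable|exact: mA| |].
    by apply/measurable_EFinP; apply: measurable_funTS; exact: measurable_normal_pdf.
  by move=> t _; rewrite lee_fin normal_pdf_ge0.
by apply: eq_measure_integral => X mX _; exact: lebesgue_measureN.
Qed.

End givens.

(** * Orthogonal symmetries of the Gaussian *)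

Section orthogonal.
Context {R : realType}.

Lemma norm2_trmx n (x : 'cV[R]_n) : norm2 x = (x^T *m x) 0 0.
Proof. by rewrite mxE; apply: eq_bigr => i _; rewrite mxE. Qed.

Lemma enorm_orthogonal n (W : 'M[R]_n) (x : 'cV[R]_n) :
  W^T *m W = 1%:M -> enorm (W *m x) = enorm x.
Proof.
move=> OO; rewrite !enormE !norm2_trmx trmx_mul mulmxA -[_ *m W^T *m W]mulmxA.
by rewrite OO mulmx1.
Qed.

(** What is used of these matrices is that they act transitively on the sphere. The ones constructed
    are products of Givens rotations, the point reflection and transposes. *)
Definition gaussian_symmetry n (gamma : probability (Rvec R n) R) (W : 'M[R]_n) :=
  W^T *m W = 1%:M /\ forall B : set (Rvec R n), measurable B ->
    gamma [set x : 'cV[R]_n | B (W *m x)] = gamma B.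

Lemma measurable_preimage_mulmx n (W : 'M[R]_n) (B : set (Rvec R n)) :
  measurable B -> measurable ([set x : 'cV[R]_n | B (W *m x)] : set (Rvec R n)).
Proof.
by move=> mB; rewrite -[X in measurable X]setTI; exact: (measurable_mulmx W).
Qed.

Lemma gaussian_symmetry_mul n (gamma : probability (Rvec R n) R) (W1 W2 : 'M[R]_n) :
  gaussian_symmetry gamma W1 -> gaussian_symmetry gamma W2 ->
  gaussian_symmetry gamma (W2 *m W1).
Proof.
move=> [W1W s1] [W2W s2]; split.
  by rewrite trmx_mul mulmxA -[_ *m W2^T *m W2]mulmxA W2W mulmx1.
move=> B mB; rewrite -(s2 B mB) -[RHS]s1; last exact: measurable_preimage_mulmx.
by congr (gamma _); apply/funext => x /=; rewrite mulmxA.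
Qed.

Lemma gaussian_symmetry_tr n (gamma : probability (Rvec R n) R) (W : 'M[R]_n) :
  gaussian_symmetry gamma W -> gaussian_symmetry gamma W^T.
Proof.
move=> [OO s]; split; first by rewrite trmxK; exact: mulmx1C.
move=> B mB; rewrite -[LHS]s; last exact: measurable_preimage_mulmx.
by congr (gamma _); apply/funext => x /=; rewrite mulmxA OO mul1mx.
Qed.

Variables (k : nat) (gamma : probability (Rvec R k.+1) R).
Hypothesis gammaN : std_normal_law gamma.

(* Givens rotations in the planes (0, l) clear the coordinates one by one. *)
Lemma gaussian_symmetry_axis (v : 'cV[R]_k.+1) : enorm v = 1 ->
  exists2 W, gaussian_symmetry gamma W & W *m v = delta_mx 0 0.
Proof.
move=> v1.
have [W symO Ov] : exists2 W, gaussian_symmetry gamma W &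
    forall l : 'I_k.+1, l != 0 -> (W *m v) l 0 = 0.
  suff H (m : nat) : exists2 W, gaussian_symmetry gamma W &
      forall l : 'I_k.+1, l != 0 -> (l <= m)%N -> (W *m v) l 0 = 0.
    by have [W sO h] := H k; exists W => // l l0; apply: h => //; rewrite -ltnS.
  elim: m => [|m [W sO h]].
    exists 1%:M; last by move=> l l0; rewrite leqn0 => /eqP l0'; case/eqP: l0; exact/val_inj.
    by split=> [|B mB];
      [rewrite trmx1 mul1mx|congr (gamma _); apply/funext => x /=; rewrite mul1mx].
  have [mk|mk] := ltnP m.+1 k.+1; last first.
    exists W => // l l0 _; apply: h => //.
    by rewrite -ltnS (leq_trans (ltn_ord l)).
  pose j : 'I_k.+1 := Ordinal mk; have j0 : 0 != j by [].
  set y := W *m v in h *; pose r := Num.sqrt (y 0 0 ^+ 2 + y j 0 ^+ 2).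
  have [r0|r0] := eqVneq r 0.
    exists W => // l l0; rewrite leq_eqVlt ltnS => /predU1P[lm|]; last exact: h.
    have -> : l = j by exact/val_inj.
    have /eqP := r0; rewrite sqrtr_eq0 => r0'; rewrite -/y.
    by apply/eqP; rewrite -sqrf_eq0 eq_le sqr_ge0 andbT (le_trans _ r0')// lerDr sqr_ge0.
  have r2 : r ^+ 2 = y 0 0 ^+ 2 + y j 0 ^+ 2 by rewrite sqr_sqrtr// addr_ge0 ?sqr_ge0.
  (* The sign of the leading coordinate makes the cosine |y_0| / r nonnegative, as [gaussian_givens]
     requires. The rotation puts e r in coordinate 0 and 0 in coordinate [j], so the sign survives
     and is dealt with at the end. *)
  pose e : R := if y 0 0 < 0 then -1 else 1.
  have e2 : e ^+ 2 = 1 by rewrite /e; case: ifP => _; rewrite ?sqrrN expr1n.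
  have ey : e * y 0 0 = `|y 0 0|.
    rewrite /e; case: ltP => y0; first by rewrite mulN1r ltr0_norm.
    by rewrite mul1r ger0_norm.
  pose c := `|y 0 0| / r; pose s := e * y j 0 / r.
  have c0 : 0 <= c by rewrite divr_ge0// sqrtr_ge0.
  have cs : c ^+ 2 + s ^+ 2 = 1.
    rewrite /c /s !exprMn e2 mul1r exprVn -mulrDl real_normK ?num_real//.
    by rewrite -r2 divff// expf_neq0.
  exists (givens 0 j c s *m W).
    apply: gaussian_symmetry_mul => //; split; first exact: givens_orthogonal.
    by move=> B mB; exact: gaussian_givens.
  move=> l l0 lm; rewrite -mulmxA givens_mulmx// (negbTE l0).
  case: eqVneq => [_|lj]; last first.
    apply: h => //; move: lm; rewrite leq_eqVlt ltnS => /predU1P[lm|//].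
    by case/eqP: lj; exact/val_inj.
  by rewrite -/y /c /s -ey; field.
have Ov1 : ((W *m v) 0 0) ^+ 2 = 1.
  have : enorm (W *m v) = 1 by rewrite enorm_orthogonal//; case: symO.
  move=> /(congr1 (fun t => t ^+ 2)); rewrite enorm_sqr expr1n /norm2 (bigD1 0)//= big1 ?addr0//.
  by move=> l l0; rewrite Ov// expr0n.
have {}Ov : W *m v = ((W *m v) 0 0) *: delta_mx 0 0.
  apply/colP => l; rewrite !mxE eqxx andbT; have [->|l0] := eqVneq l 0; first by rewrite mulr1.
  by rewrite mulr0; have := Ov l l0; rewrite mxE.
have /orP[/eqP o1|/eqP o1] : ((W *m v) 0 0 == 1) || ((W *m v) 0 0 == -1).
  by rewrite -eqf_sqr Ov1 expr1n.
  by exists W => //; rewrite Ov o1 scale1r.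
exists ((-1)%:M *m W).
  apply: gaussian_symmetry_mul => //; split; last by move=> B mB; exact: gaussian_opp.
  by rewrite tr_scalar_mx -scalar_mxM mulrNN mulr1.
by rewrite -mulmxA Ov o1 mul_scalar_mx scalerA mulrNN mulr1 scale1r.
Qed.

Lemma gaussian_symmetry_transitive (v w : 'cV[R]_k.+1) :
  enorm v = 1 -> enorm w = 1 ->
  exists2 W, gaussian_symmetry gamma W & W *m v = w.
Proof.
move=> /gaussian_symmetry_axis[W sO Ov] /gaussian_symmetry_axis[W' sO' Ow].
exists (W'^T *m W).
  by apply: gaussian_symmetry_mul => //; exact: gaussian_symmetry_tr.
by rewrite -mulmxA Ov -Ow mulmxA; case: sO' => -> _; rewrite mul1mx.
Qed.

End orthogonal.

(** * Sublevel sets and the polar decomposition of the Gaussian *)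

Section sublevel.
Context {R : realType} {n : nat} (G : 'cV[R]_n -> R).
Hypothesis cG : continuous G.

Lemma open_setC_sublevel : open (~` [set x | G x <= 0]).
Proof.
rewrite (_ : ~` _ = G @^-1` `]0, +oo[%classic); last first.
  apply/seteqP; split => x /=; rewrite in_itv/= andbT ltNge; first by move/negP.
  by move=> h; apply/negP.
by apply: open_comp => [x _|]; [exact: cG|exact: interval_open].
Qed.

Lemma measurable_continuous_sublevel :
  measurable ([set x | G x <= 0] : set (Rvec R n)).
Proof.
rewrite -[X in measurable X]setCK; apply: measurableC.
exact: sub_sigma_algebra open_setC_sublevel.
Qed.

End sublevel.

Section polar.
Context {R : realType} {k : nat}.
Local Notation n := k.+1.
Local Open Scope ereal_scope.
Local Notation V := (Rvec R n).
Implicit Types (x v : 'cV[R]_n) (e : R).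
Variables gamma sigma : probability V R.
Hypothesis gammaN : std_normal_law gamma.
Hypothesis sigmaU : uniform_sphere_law sigma.

Let measurable_fst_coord i : measurable_fun setT (fun p : V * V => (p.1 : 'cV[R]_n) i 0%R).
Proof.
by apply: (measurableT_comp (measurable_coord i)); exact: measurable_fst.
Qed.

Let measurable_snd_coord i : measurable_fun setT (fun p : V * V => (p.2 : 'cV[R]_n) i 0%R).
Proof.
by apply: (measurableT_comp (measurable_coord i)); exact: measurable_snd.
Qed.

Let measurable_fst_enorm : measurable_fun setT (fun p : V * V => enorm (p.1 : 'cV[R]_n)).
Proof.
by apply: (measurableT_comp measurable_enorm); exact: measurable_fst.
Qed.

(* [dilate (x, v)] moves x to direction v, keeping its radius when |v| = 1. *)
Definition dilate (p : V * V) : V := (enorm (p.1 : 'cV[R]_n) *: (p.2 : 'cV[R]_n))%R.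

Lemma measurable_dilate : measurable_fun setT dilate.
Proof.
apply: measurable_fun_Rvec => i; rewrite /dilate; under eq_fun do rewrite mxE.
exact: measurable_funM.
Qed.

(** The kernel K_e. A tolerance proportional to |x| makes it homogeneous in x, and the form without
    a quotient is meaningful at x = 0 as well. *)
Definition near_direction e : set (V * V) :=
  [set p | (enorm ((p.1 : 'cV[R]_n) - dilate p) <= e * enorm (p.1 : 'cV[R]_n))%R].

Lemma measurable_near_direction e : measurable (near_direction e).
Proof.
pose f (p : V * V) : R :=
  (enorm ((p.1 : 'cV[R]_n) - dilate p) - e * enorm (p.1 : 'cV[R]_n))%R.
have mf : measurable_fun setT f.
  apply: measurable_funB; last exact: measurable_funM.
  have md : measurable_fun setT (fun p : V * V => ((p.1 : 'cV[R]_n) - dilate p)%R : V).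
    apply: measurable_fun_Rvec => i; rewrite /dilate.
    under eq_fun do rewrite !mxE.
    by apply: measurable_funB => //; exact: measurable_funM.
  by apply: (measurableT_comp measurable_enorm); exact: md.
rewrite (_ : near_direction e = setT `&` f @^-1` `]-oo, 0%R]%classic).
  by apply: mf => //; exact: measurable_itv.
by apply/seteqP; split => p; rewrite /near_direction/= in_itv/= subr_le0 => // -[].
Qed.

Let e0 : 'cV[R]_n := delta_mx 0%R 0%R.

Lemma enorm_delta_mx : enorm (delta_mx 0%R 0%R : 'cV[R]_n) = 1%R.
Proof.
rewrite enormE /norm2 (bigD1 0%R)//= big1 ?addr0; last first.
  by move=> i i0; rewrite mxE (negbTE i0) expr0n.
by rewrite mxE !eqxx expr1n sqrtr1.
Qed.

Lemma near_directionZ e (t : R) x v : (0 < t)%R ->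
  near_direction e (t *: x, v)%R <-> near_direction e (x, v).
Proof.
move=> t0; rewrite /near_direction/dilate/= !enormZ gtr0_norm// -scalerA -scalerBr.
by rewrite enormZ gtr0_norm// mulrCA ler_pM2l.
Qed.

Lemma near_direction_orthogonal e (W : 'M[R]_n) x v : W^T *m W = 1%:M ->
  near_direction e (W *m x, W *m v) <-> near_direction e (x, v).
Proof.
move=> WW; rewrite /near_direction/dilate/= enorm_orthogonal//.
by rewrite scalemxAr -mulmxBr enorm_orthogonal.
Qed.

Definition direction_mass e : \bar R := sigma (xsection (near_direction e) e0).

(** Normalise x and turn it to [e0]: the kernel is unchanged when both arguments turn together, and
    [sigma] ignores the turn of v. *)
Lemma sigma_near_direction e x : x != 0%R ->
  sigma (xsection (near_direction e) x) = direction_mass e.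
Proof.
move=> x0; have nx0 : (0 < enorm x)%R.
  by rewrite lt0r enorm_ge0 andbT; apply: contra x0 => /eqP /enorm_eq0 ->.
pose u : 'cV[R]_n := ((enorm x)^-1 *: x)%R.
have u1 : enorm u = 1%R by rewrite enormZ gtr0_norm ?invr_gt0// mulVf// gt_eqF.
have [W [WW _] Wu0] := gaussian_symmetry_axis gammaN u1.
have Wu : (W *m u = e0)%R by [].
have [_ sW] := sigmaU.
have mS := measurable_xsection (x : V) (measurable_near_direction e).
have mS0 := measurable_xsection (e0 : V) (measurable_near_direction e).
rewrite /direction_mass -(sW W WW _ mS0); congr (sigma _).
apply/funext => v; rewrite /xsection/= !inE; apply/propext.
by rewrite -Wu near_direction_orthogonal// near_directionZ ?invr_gt0.
Qed.

Lemma ae_sphere : {ae sigma, forall v, enorm (v : 'cV[R]_n) = 1%R}.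
Proof.
have mS : measurable (sphere (n := n) : set V).
  rewrite (_ : sphere (n := n) = setT `&` (@enorm R n : V -> measurableTypeR R) @^-1` [set 1%R]).
    by apply: measurable_enorm => //; exact: measurable_set1.
  by rewrite setTI.
exists (~` (sphere (n := n))); split; [exact: measurableC| |by []].
by rewrite probability_setC//; case: sigmaU => -> _; rewrite subee.
Qed.

Let ae_neq0 : {ae gamma, forall x, (x : 'cV[R]_n) != 0%R}.
Proof.
exists [set x : 'cV[R]_n | enorm x = 0%R]; split.
- rewrite (_ : [set x | _] = setT `&` (@enorm R n : V -> measurableTypeR R) @^-1` [set 0%R]).
    by apply: measurable_enorm => //; exact: measurable_set1.
  by rewrite setTI.
- exact: gamma_enorm_eq0.
- move=> x /= /negP; rewrite negbK => /eqP ->.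
  by rewrite enormE /norm2 big1 ?sqrtr0// => i _; rewrite mxE expr0n.
Qed.

(** The left-hand side is the same for all unit vectors, by transitivity of the symmetries of
    [gamma], so it equals its average over [sigma]. After Tonelli the inner [sigma]-mass is
    [direction_mass e] for almost every x with |x| in D. *)
Lemma gamma_near_direction e (D : set R) v : measurable D -> enorm v = 1%R ->
  gamma [set x : 'cV[R]_n | D (enorm x) /\ near_direction e (x, v)] =
  direction_mass e * gamma [set x : 'cV[R]_n | D (enorm x)].
Proof.
move=> mD v1; pose E : set (V * V) :=
  [set p | D (enorm (p.1 : 'cV[R]_n))] `&` near_direction e.
have mE : measurable E.
  apply: measurableI; last exact: measurable_near_direction.
  by rewrite -[X in measurable X]setTI; exact: measurable_fst_enorm.
have qE w : [set x : 'cV[R]_n | D (enorm x) /\ near_direction e (x, w)] =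
    ysection E (w : V).
  by apply/funext => x; apply/propext; rewrite /ysection/= inE.
have qcst w : enorm w = 1%R -> gamma (ysection E (w : V)) = gamma (ysection E (v : V)).
  move=> w1; have [W [WW sW] Wv] := gaussian_symmetry_transitive gammaN v1 w1.
  rewrite -[LHS]sW; last exact: measurable_ysection.
  congr (gamma _); apply/funext => x; rewrite /ysection/= !inE; apply/propext.
  by rewrite /E/= enorm_orthogonal// -Wv near_direction_orthogonal.
have mDx : measurable ([set x : 'cV[R]_n | D (enorm x)] : set V).
  by rewrite -[X in measurable X]setTI; exact: measurable_enorm.
transitivity ((gamma \x sigma) E).
  rewrite product_measure_ysection// qE.
  transitivity (\int[sigma]_w cst (gamma (ysection E (v : V))) w).
    rewrite integral_cst// [X in _ * X](_ : _ = 1) ?mule1//.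
    exact: probability_setT.
  apply: ge0_ae_eq_integral => //.
  - exact: measurable_fun_ysection.
  - by apply: (@filterS _ _ (ae_filter_ringOfSetsType sigma) _ _ _ ae_sphere) => w w1 _;
      exact/esym/(qcst w w1).
transitivity (\int[gamma]_(x in [set x : 'cV[R]_n | D (enorm x)]) cst (direction_mass e) x).
  rewrite [RHS]integral_mkcond; apply: ge0_ae_eq_integral => //.
  - exact: measurable_fun_xsection.
  - by apply/(measurable_restrictT _ _).1.
  - by move=> x _; apply: erestrict_ge0 => ? _; exact: measure_ge0.
  - apply: (@filterS _ _ (ae_filter_ringOfSetsType gamma) _ _ _ ae_neq0) => x x0 _;
      rewrite patchE; case: ifPn; rewrite ?inE/= => Dx.
      rewrite -(sigma_near_direction e x0); congr (sigma _).
      by apply/funext => w; apply/propext; rewrite /xsection/= !inE; split=> [[]//|].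
    transitivity (sigma set0); last exact: measure0.
    congr (sigma _); apply/seteqP; split => // w.
    rewrite /xsection/= inE => -[] /= DX _.
    by case/negP: Dx; rewrite inE.
by rewrite integral_cst.
Qed.

Lemma coord_le_enorm x i : (`|x i 0%R| <= enorm x)%R.
Proof.
rewrite -sqrtr_sqr ler_wsqrtr// /norm2 (bigD1 i)//= lerDl.
by apply: sumr_ge0 => l _; exact: sqr_ge0.
Qed.

(** If the mass were 0, all sections at nonzero points would be null. Each small cell meeting the
    sphere has its spherical part inside the section at one of its points, and countably many cells
    cover the sphere, which would then be null. *)
Lemma direction_mass_gt0 e : (0 < e)%R -> 0 < direction_mass e.
Proof.
move=> e_gt0; rewrite lt0e measure_ge0 andbT; apply/eqP => mass0.
have n_gt0 : (0 < n%:R :> R)%R by [].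
(* Side below e / n: two points of a cell are then at Euclidean distance at most e / sqrt n, hence
   at most e. *)
have [m] := @ltr_add_invr R 0%R (e / n%:R) (divr_gt0 e_gt0 n_gt0).
rewrite add0r => me.
pose F (i : nat) : set V := if @unpickle {ffun 'I_n -> int} i is Some z
  then grid_cell m z `&` sphere (n := n) else set0.
suff Fneg i : sigma.-negligible (F i).
  have /negligibleS : sigma.-negligible (\bigcup_i F i) by exact: negligible_bigcup.
  move=> /(_ (sphere (n := n))) [].
    move=> x x1; pose z := [ffun l => Num.floor (m.+1%:R * x l 0)%R].
    exists (pickle z) => //; rewrite /F pickleK; split=> //.
    exact: grid_cell_cover.
  move=> N [mN N0 SN]; have [sS _] := sigmaU.
  have : sigma (sphere (n := n)) <= 0.
    rewrite -N0; apply: le_measure; rewrite ?inE//.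
    rewrite (_ : sphere (n := n) = setT `&` (@enorm R n : V -> measurableTypeR R) @^-1` [set 1%R]).
      by apply: measurable_enorm => //; exact: measurable_set1.
    by rewrite setTI.
  by rewrite [X in X <= _]sS lee_fin ler10.
rewrite /F; case: unpickle => [z|]; last exact: negligible_set0.
have [[x [zx x1]]|noz] := pselect (exists x, grid_cell m z x /\ enorm x = 1%R); last first.
  rewrite (_ : _ `&` _ = set0); first exact: negligible_set0.
  by apply/seteqP; split => // x zx; apply: noz; exists x.
have x0 : x != 0%R.
  apply: contra_eq_neq x1 => ->.
  by rewrite enormE /norm2 big1 ?sqrtr0 1?eq_sym ?oner_eq0// => i' _; rewrite mxE expr0n.
exists (xsection (near_direction e) (x : V)); split.
- exact: measurable_xsection (measurable_near_direction e).
- by rewrite sigma_near_direction.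
move=> v [zv v1]; rewrite /xsection/= inE /near_direction/dilate/= x1 mulr1 scale1r.
rewrite enormE -(ger0_norm (ltW e_gt0)) -sqrtr_sqr ler_wsqrtr//.
apply: (@le_trans _ _ (\sum_(i0 < n) (e / n%:R) ^+ 2)%R).
  apply: ler_sum => l _; rewrite !mxE -[leLHS]real_normK ?num_real//.
  rewrite lerXn2r ?nnegrE// ?divr_ge0 ?(ltW e_gt0)//.
  by apply: ltW; apply: lt_trans me; exact: grid_cell_dist zx zv _.
rewrite sumr_const card_ord -[leLHS]mulr_natl exprMn exprVn mulrCA -[leRHS]mulr1.
rewrite ler_wpM2l ?sqr_ge0// expr2 invfM mulrA mulfV ?gt_eqF// mul1r.
by rewrite invf_le1// ler1n.
Qed.

Definition polar_law (B : set V) : \bar R := (gamma \x sigma) (dilate @^-1` B).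

(** For a fixed unit v the condition |x| v in B concerns |x| alone, so [gamma_near_direction]
    separates it from the kernel; the two orders of integration give the two sides. *)
Lemma direction_mass_polar_law e (B : set V) : measurable B ->
  direction_mass e * polar_law B =
  \int[gamma]_x sigma (xsection (near_direction e `&` dilate @^-1` B) x).
Proof.
move=> mB.
have mdB : measurable (dilate @^-1` B).
  by rewrite -[X in measurable X]setTI; exact: measurable_dilate.
have mE : measurable (near_direction e `&` dilate @^-1` B).
  by apply: measurableI => //; exact: measurable_near_direction.
transitivity ((gamma \x sigma) (near_direction e `&` dilate @^-1` B)); last by [].
rewrite /polar_law !product_measure_ysection//.
rewrite -ge0_integralZl//; last exact: measurable_fun_ysection.
apply: ge0_ae_eq_integral => //.
- by apply: measurable_funeM; exact: measurable_fun_ysection.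
- exact: measurable_fun_ysection.
- by move=> v _; rewrite mule_ge0.
apply: (@filterS _ _ (ae_filter_ringOfSetsType sigma) _ _ _ ae_sphere) => v v1 _.
pose D : set R := [set r | B (r *: (v : 'cV[R]_n))%R].
have mD : measurable D.
  have mf : measurable_fun setT (fun r : R => (r *: (v : 'cV[R]_n))%R : V).
    apply: measurable_fun_Rvec => l; under eq_fun do rewrite mxE.
    exact: measurable_funM.
  by rewrite -[X in measurable X]setTI; exact: mf.
transitivity (direction_mass e * gamma [set x : 'cV[R]_n | D (enorm x)]).
  congr (_ * gamma _); apply/funext => x; apply/propext.
  by rewrite /ysection/= inE.
rewrite -(gamma_near_direction e mD v1); congr (gamma _); apply/funext => x; apply/propext.
by rewrite /ysection/= inE /= /D/=; split=> -[].
Qed.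

Lemma limn_einf_ge0 (u : (\bar R)^nat) : (forall m, 0 <= u m) -> 0 <= limn_einf u.
Proof.
move=> u0; rewrite limn_einf_lim; apply: lime_ge; first exact: is_cvg_einfs.
by apply: nearW => m; apply: le_ereal_inf_tmp => _ [l /= _ <-]; exact: u0.
Qed.

(** Division by [direction_mass] gives functions [f m] with one and the same integral [polar_law U],
    and at almost every point of [U] they are eventually equal to 1. *)
Lemma open_le_polar_law (U : set 'cV[R]_n) : open U ->
  gamma (U : set V) <= polar_law U.
Proof.
move=> oU; have mU : measurable (U : set V) by exact: sub_sigma_algebra.
pose e (m : nat) : R := m.+1%:R^-1%R.
have e_gt0 m : (0 < e m)%R by rewrite invr_gt0.
have mass_fin m : direction_mass (e m) \is a fin_num.
  by apply: fin_num_measure; exact: measurable_xsection (measurable_near_direction _).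
have mass_gt0 m : (0 < fine (direction_mass (e m)))%R.
  by rewrite fine_gt0// direction_mass_gt0//= -ge0_fin_numE ?measure_ge0.
pose E m := near_direction (e m) `&` dilate @^-1` (U : set V).
have mE m : measurable (E m).
  apply: measurableI; first exact: measurable_near_direction.
  by rewrite -[X in measurable X]setTI; exact: measurable_dilate.
pose f m (x : V) := ((fine (direction_mass (e m)))^-1)%:E * sigma (xsection (E m) x).
have f0 m x : 0 <= f m x by rewrite mule_ge0// lee_fin invr_ge0 ltW.
have mf m : measurable_fun setT (f m).
  by apply: measurable_funeM; exact: measurable_fun_xsection.
have intf m : \int[gamma]_x f m x = polar_law U.
  rewrite ge0_integralZl//; last 2 first.
  - exact: measurable_fun_xsection.
  - by rewrite lee_fin invr_ge0 ltW.
  rewrite -direction_mass_polar_law// muleA -[X in _ * X * _](fineK (mass_fin m)).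
  by rewrite -EFinM mulVf ?gt_eqF// mul1e.
have : \int[gamma]_x limn_einf (f^~ x) <= polar_law U.
  apply: (le_trans (fatou gamma measurableT mf (fun m x _ => f0 m x))).
  rewrite (_ : (fun m => _) = fun=> polar_law U); last by apply/funext => m; exact: intf.
  by rewrite is_cvg_limn_einfE; [rewrite lim_cst|exact: is_cvg_cst].
apply: le_trans.
rewrite -[leLHS]mul1e -(integral_cst gamma mU) integral_mkcond.
apply: ae_ge0_le_integral => //.
- by move=> x _; apply: erestrict_ge0.
- by apply/(measurable_restrictT _ _).1.
- by move=> x _; apply: limn_einf_ge0 => m; exact: f0.
- have mNf m : measurable_fun setT (fun x : V => - f m x) by exact: measurableT_comp.
  by apply: measurableT_comp => //; exact: (measurable_fun_limn_esup mNf).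
apply: (@filterS _ _ (ae_filter_ringOfSetsType gamma) _ _ _ ae_neq0) => x x0 _.
rewrite patchE; case: ifPn => [|_]; last by apply: limn_einf_ge0 => m; exact: f0.
rewrite inE => Ux; have /nbhs_ballP[d /= d0 dU] := open_nbhs_nbhs (conj oU Ux).
have nx0 : (0 < enorm (x : 'cV[R]_n))%R.
  by rewrite lt0r enorm_ge0 andbT; apply: contra x0 => /eqP /enorm_eq0 ->.
have [M] := @ltr_add_invr R 0%R (d / enorm (x : 'cV[R]_n)) (divr_gt0 d0 nx0).
rewrite add0r => Md.
(* As soon as 1/(m+1) < d / |x|, every v in the section has |x| v in the sup-norm ball of radius d
   about x, hence in [U]; intersecting with the preimage of [U] then removes nothing. *)
have cf : f^~ x @ \oo --> (1 : \bar R).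
  apply: cvg_near_cst; exists M => // m /= Mm.
  rewrite /f (_ : xsection (E m) x = xsection (near_direction (e m)) x).
    rewrite sigma_near_direction// -[X in _ * X](fineK (mass_fin m)) -EFinM.
    by rewrite mulVf// gt_eqF.
  apply/funext => v; apply/propext; rewrite /xsection/= !inE; split=> [[]//|xv].
  split=> //; apply: dU; split=> // l l'; rewrite (ord1 l') /ball/=.
  have := coord_le_enorm ((x : 'cV[R]_n) - dilate (x, v)) l; rewrite !mxE => /le_lt_trans; apply.
  apply: le_lt_trans xv _; rewrite -ltr_pdivlMr//; apply: le_lt_trans Md.
  by rewrite lef_pV2 ?posrE// ler_nat.
by rewrite is_cvg_limn_einfE; [rewrite (cvg_lim _ cf)|exact: cvgP cf].
Qed.

(** The open sets G < 1/(m+1) decrease to [C] and give [gamma C <= mu C]; the open complement of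
    [C], with both total masses equal to 1, gives the converse. *)
Lemma polar_decomposition (G : 'cV[R]_n -> R) : continuous G ->
  gamma [set x | (G x <= 0)%R] =
  \int[sigma]_v gamma [set x : 'cV[R]_n | (G (enorm x *: (v : 'cV[R]_n)) <= 0)%R].
Proof.
move=> cG; pose C : set V := [set x : 'cV[R]_n | (G x <= 0)%R].
have oG (c : R) : open [set x : 'cV[R]_n | (G x < c)%R].
  rewrite (_ : [set x | _] = G @^-1` `]-oo, c[%classic); last first.
    by apply/seteqP; split => x /=; rewrite in_itv/=.
  by apply: open_comp => [x _|]; [exact: cG|exact: interval_open].
have oC : open (~` C : set 'cV[R]_n) by exact: open_setC_sublevel.
have mC : measurable C by exact: measurable_continuous_sublevel.
have mdil (B : set V) : measurable B -> measurable (dilate @^-1` B).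
  by move=> mB; rewrite -[X in measurable X]setTI; exact: measurable_dilate.
pose mu_ : {measure set V -> \bar R} := pushforward (gamma \x sigma) dilate.
pose mu := mu_ measurable_dilate.
have muT : mu setT = 1.
  transitivity ((gamma \x sigma) (setT `*` setT)); first by rewrite setXTT.
  by rewrite product_measure1E// -[RHS]mule1; congr (_ * _); exact: probability_setT.
have muC_fin B : measurable B -> mu B \is a fin_num.
  move=> mB; rewrite ge0_fin_numE ?measure_ge0//; apply: (@le_lt_trans _ _ (mu setT)).
    by apply: le_measure; rewrite ?inE.
  by rewrite muT ltry.
transitivity (mu C); last first.
  rewrite [LHS](_ : _ = (gamma \x sigma) (dilate @^-1` C))//.
  rewrite product_measure_ysection; last exact: mdil.
  apply: eq_integral => v _; congr (gamma _); apply/funext => x; apply/propext.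
  by rewrite /ysection/= inE.
apply/eqP; rewrite eq_le; apply/andP; split.
  pose F (m : nat) : set V := [set x : 'cV[R]_n | (G x < m.+1%:R^-1)%R].
  have mF m : measurable (F m) by apply: sub_sigma_algebra; exact: oG.
  have capF : \bigcap_m F m = C.
    apply/seteqP; split => [x Fx|x Cx m _]; last by apply: (le_lt_trans Cx).
    rewrite /C/= leNgt; apply/negP => /ltr_add_invr[m]; rewrite add0r => mx.
    by have := Fx m I; rewrite /F/= => /(lt_trans mx); rewrite ltxx.
  have cvF : (mu \o F) m @[m --> \oo] --> mu C.
    rewrite -capF; apply: nonincreasing_cvg_mu => //; last 2 first.
    - by rewrite capF.
    - move=> a b ab; rewrite subsetEset => x; rewrite /F/= => /lt_le_trans; apply.
      by rewrite lef_pV2 ?posrE// ler_nat ltnS.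
    by rewrite -ge0_fin_numE ?measure_ge0// muC_fin.
  apply: cvge_ge cvF; apply: nearW => m /=.
  apply: (@le_trans _ _ (gamma (F m))).
    by apply: le_measure; rewrite ?inE// => x; rewrite /C/= => /le_lt_trans; apply.
  by apply: open_le_polar_law; exact: oG.
have mUC (m : {measure set V -> \bar R}) : m setT = m (~` C) + m C.
  rewrite -measureU//; [by rewrite setvU|exact: measurableC|].
  by rewrite setICl.
have := open_le_polar_law oC; rewrite -[polar_law _]/(mu (~` C)) => le1.
have gT : gamma setT = 1 by exact: probability_setT.
have mnC : measurable (~` C) by exact: measurableC.
have gfin B : measurable B -> gamma B \is a fin_num by exact: fin_num_measure.
have : 1 = gamma (~` C) + gamma C by rewrite -gT; exact: mUC.
have : 1 = mu (~` C) + mu C by rewrite -muT; exact: mUC.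
move: le1; rewrite -(fineK (muC_fin _ mC)) -(fineK (muC_fin _ mnC)).
rewrite -(fineK (gfin _ mC)) -(fineK (gfin _ mnC)) -!EFinD !lee_fin.
by move=> le1 [] h1 [] h2; lra.
Qed.

End polar.

(** * The Bhatia-Davis inequality *)

Section bhatia_davis.
Context d (T : measurableType d) {R : realType} (Q : probability T R).
Local Open Scope ereal_scope.

(* Integrating 0 <= (b - X)(X - a). *)
Lemma bhatia_davis (X : T -> R) (a b p : R) : measurable_fun setT X ->
  (a <= b)%R -> {ae Q, forall w, (a <= X w <= b)%R} ->
  \int[Q]_w (X w)%:E = p%:E ->
  \int[Q]_w ((X w - p) ^+ 2)%:E <= ((b - p) * (p - a))%:E.
Proof.
(* [X] lies in [a, b] only almost surely; its truncation [Y] does so everywhere and is therefore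
   integrable. *)
move=> mX ab aeX EX; pose Y w := Num.max a (Num.min b (X w)).
have mY : measurable_fun setT Y by apply: measurable_maxr => //; exact: measurable_minr.
have Yab w : (a <= Y w <= b)%R by rewrite /Y le_max lexx ge_max ab ge_min lexx.
have aeXY : {ae Q, forall w, X w = Y w}.
  apply: (@filterS _ _ (ae_filter_ringOfSetsType Q) _ _ _ aeX) => w /andP[aX Xb].
  by rewrite /Y min_r// max_r.
have mXE : measurable_fun setT (EFin \o X) by exact/measurable_EFinP.
have mYE : measurable_fun setT (EFin \o Y) by exact/measurable_EFinP.
have EY : \int[Q]_w (Y w)%:E = p%:E.
  rewrite -EX; apply: ae_eq_integral => //.
  by apply: (@filterS _ _ (ae_filter_ringOfSetsType Q) _ _ _ aeXY) => w -> _.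
have iY : Q.-integrable setT (EFin \o Y).
  apply: measurable_bounded_integrable => //.
    by rewrite (le_lt_trans (probability_le1 _ _))// ltry.
  exists (Num.max `|a| `|b|)%R; split; first exact: num_real.
  move=> x xM w _; apply: ltW; apply: le_lt_trans xM; have /andP[aY Yb] := Yab w.
  rewrite le_max; have [Y0|Y0] := leP 0%R (Y w).
    by rewrite (ger0_norm Y0) (le_trans Yb (ler_norm b)) orbT.
  by rewrite (ltr0_norm Y0) -[`|a|%R]normrN (le_trans _ (ler_norm (- a)))// lerN2.
have m2 (Z : T -> R) : measurable_fun setT Z -> measurable_fun setT (fun w => ((Z w - p) ^+ 2)%:E).
  move=> mZ; apply/measurable_EFinP; apply: measurable_funX.
  exact: measurable_funB.
rewrite (ae_eq_integral (fun w => ((Y w - p) ^+ 2)%:E))//; last 3 first.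
- exact: m2.
- exact: m2.
- by apply: (@filterS _ _ (ae_filter_ringOfSetsType Q) _ _ _ aeXY) => w -> _.
(* With these constants (Y - p)^2 <= c Y + e is (b - Y)(Y - a) >= 0 rearranged, and c p + e = (b -
   p)(p - a). *)
pose c : R := (a + b - 2 * p)%R.
pose e : R := (p ^+ 2 - a * b)%R.
apply: (@le_trans _ _ (\int[Q]_w (c%:E * (Y w)%:E + e%:E))).
  apply: ge0_le_integral => //.
  - by move=> w _; rewrite lee_fin sqr_ge0.
  - exact: m2.
  - by apply: emeasurable_funD => //; exact: measurable_funeM.
  - move=> w _; rewrite -EFinM -EFinD lee_fin /c /e; have /andP[aY Yb] := Yab w.
    by nra.
rewrite integralD//; last 2 first.
- exact: integrableZl.
- exact: finite_measure_integrable_cst.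
have Ee : \int[Q]_w e%:E = e%:E.
  rewrite integral_cst// -[RHS]mule1; congr (_ * _); exact: probability_setT.
rewrite integralZl// EY Ee -EFinM -EFinD lee_fin /c /e.
by nra.
Qed.

End bhatia_davis.

(** * Continuity of convex functions *)

Section convex.
Context {R : realType} {n : nat}.
Implicit Types (f : 'cV[R]_n -> R) (x y : 'cV[R]_n).

Definition convex_ineq f := forall (t : R) x y, 0 <= t -> t <= 1 ->
  f (t *: x + (1 - t) *: y) <= t * f x + (1 - t) * f y.

Lemma convex_function_ineq f : convex_function [set: 'cV[R]_n] f -> convex_ineq f.
Proof.
by move=> cf t x y t0 t1; exact: (cf (Itv01 t0 t1) x y (in_setT _) (in_setT _)).
Qed.

Lemma convex_ineq_affine f (c : 'cV[R]_n) (A : 'M[R]_n) :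
  convex_ineq f -> convex_ineq (fun x => f (c + A *m x)).
Proof.
move=> cf t x y t0 t1; rewrite mulmxDr -!scalemxAr.
rewrite (_ : c + _ = t *: (c + A *m x) + (1 - t) *: (c + A *m y)); first exact: cf.
by rewrite !scalerDr scalerBl scale1r [(1 - t) *: c]scalerBl scale1r addrACA subrKC.
Qed.

Lemma convex_half f x y : convex_ineq f ->
  f (2^-1 *: (x + y)) <= (f x + f y) / 2.
Proof.
move=> cf; have := @cf 2^-1 x y; rewrite invr_ge0 invf_le1// ler1n.
rewrite (_ : 1 - 2^-1 = 2^-1 :> R); last by lra.
by rewrite -scalerDr -mulrDr [(f x + _) / 2]mulrC; apply.
Qed.

(** On either half of the segment convexity puts f below the chord from y; the sum of the absolute
    slopes serves for both signs of s. *)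
Lemma convex_segment f y (e : 'cV[R]_n) (s : R) : convex_ineq f -> `|s| <= 1 ->
  f (y + s *: e) <= f y + `|s| * (`|f (y + e) - f y| + `|f (y - e) - f y|).
Proof.
move=> cf; have H (e' : 'cV[R]_n) (r : R) : 0 <= r -> r <= 1 ->
    f (y + r *: e') <= f y + r * (f (y + e') - f y).
  move=> r0 r1; have -> : y + r *: e' = r *: (y + e') + (1 - r) *: y.
    by rewrite scalerDr scalerBl scale1r [RHS]addrC addrA subrK.
  by apply: le_trans (cf _ _ _ r0 r1) _; rewrite le_eqVlt; apply/orP; left; apply/eqP; ring.
have [s0|s0] := leP 0 s.
  rewrite ger0_norm// => s1; apply: le_trans (H e s s0 s1) _.
  rewrite lerD2l ler_wpM2l// (le_trans (ler_norm _))// lerDl//.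
rewrite ltr0_norm// => s1; have := H (- e) (- s); rewrite scalerN scaleNr opprK.
move=> /(_ _ s1) h; apply: le_trans (h _) _; first by rewrite oppr_ge0 ltW.
by rewrite lerD2l ler_wpM2l ?oppr_ge0 ?(ltW s0)// (le_trans (ler_norm _))// lerDr.
Qed.

(* One coordinate at a time: y + a + b is the midpoint of y + 2a and y + 2b. *)
Lemma convex_upper_bound f y : convex_ineq f ->
  exists2 d : R * R, (0 <= d.1) && (0 < d.2) & forall (h : 'cV[R]_n) (s : R),
    0 <= s -> s <= d.2 -> (forall i, `|h i 0| <= s) -> f (y + h) <= f y + s * d.1.
Proof.
move=> cf.
suff H (k : nat) : exists2 d : R * R, (0 <= d.1) && (0 < d.2) &
    forall (h : 'cV[R]_n) (s : R), 0 <= s -> s <= d.2 ->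
    (forall i, `|h i 0| <= s) -> (forall i : 'I_n, (k <= i)%N -> h i 0 = 0) ->
    f (y + h) <= f y + s * d.1.
  have [d d0 hd] := H n; exists d => // h s s0 sd hs.
  by apply: hd => // i; rewrite leqNgt ltn_ord.
elim: k => [|k [[M d] /= /andP[M0 d0] hd]].
  exists (0, 1); first by rewrite /= lexx ltr01.
  move=> h s _ _ _ h0; rewrite mulr0 addr0 (_ : h = 0) ?addr0//.
  by apply/colP => i; rewrite h0// mxE.
have [kn|nk] := ltnP k n; last first.
  exists (M, d); first by rewrite M0.
  move=> h s s0 sd hs h0; apply: hd => // i ki.
  by have := leq_trans (ltn_ord i) (leq_trans nk ki); rewrite ltnn.
pose o := Ordinal kn; pose e : 'cV[R]_n := delta_mx o 0.
pose Me := `|f (y + e) - f y| + `|f (y - e) - f y|.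
have Me0 : 0 <= Me by rewrite addr_ge0.
(* The halved radius pays for the doubled displacements: 2 a must stay within the earlier radius
   [d], and 2 h_o within the range [-1, 1] of [convex_segment]. The factor 1/2 of the midpoint
   brings the slope back to M + Me. *)
exists (M + Me, Num.min d 1 / 2); first by rewrite /= addr_ge0//= divr_gt0// lt_min d0 ltr01.
move=> h s s0 /= sd hs h0.
have [s2d s21] : s * 2 <= d /\ s * 2 <= 1.
  by move: sd; rewrite ler_pdivlMr// le_min => /andP[].
pose a : 'cV[R]_n := \col_i (if i == o then 0 else h i 0).
have hE : y + h = 2^-1 *: ((y + 2 *: a) + (y + (2 * h o 0) *: e)).
  apply/colP => i; rewrite !mxE eqxx andbT; have [->|_] := eqVneq i o.
    by rewrite mulr1n; field.
  by rewrite mulr0n; field.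
rewrite hE; apply: le_trans (convex_half _ _ cf) _.
have Ha : f (y + 2 *: a) <= f y + (s * 2) * M.
  apply: hd => // [|i|i ki]; first by rewrite mulr_ge0.
    rewrite !mxE; case: ifP => _; first by rewrite mulr0 normr0 mulr_ge0.
    by rewrite normrM ger0_norm// mulrC ler_pM2r.
  rewrite !mxE; case: eqVneq => [_|io]; first by rewrite mulr0.
  rewrite h0 ?mulr0// ltn_neqAle ki andbT; apply: contra_neq io => ik.
  exact/val_inj.
have Hb : f (y + (2 * h o 0) *: e) <= f y + (s * 2) * Me.
  have h2 : `|2 * h o 0| <= s * 2 by rewrite normrM ger0_norm// mulrC ler_pM2r.
  apply: le_trans (convex_segment _ _ cf (le_trans h2 s21)) _.
  by rewrite lerD2l ler_wpM2r.
by lra.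
Qed.

(** The local upper bound is used at x and at the reflected point 2 y - x. As y is their midpoint,
    the bound at the reflected point becomes a lower bound for f x. *)
Lemma convex_continuous f : convex_ineq f -> continuous f.
Proof.
move=> cf y; have [[M d] /= /andP[M0 d0] hd] := convex_upper_bound y cf.
apply/(@cvgrPdist_lt _ _ _ (nbhs y) (nbhs_filter y)) => eps eps0.
have M1 : 0 < M + 1 by rewrite ltr_wpDl.
pose s := Num.min d (eps / (M + 1) / 2).
have s0 : 0 < s by rewrite lt_min d0 !divr_gt0.
have sd : s <= d by rewrite ge_min lexx.
have sM : s * M < eps.
  have : s <= eps / (M + 1) / 2 by rewrite ge_min lexx orbT.
  rewrite ler_pdivlMr// ler_pdivlMr// => h; nra.
apply/nbhs_ballP; exists s => //= x [_ xy].
have hi i : `|(x - y) i 0| <= s.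
  by rewrite !mxE distrC ltW//; exact: (xy i 0).
have up := hd (x - y) s (ltW s0) sd hi.
have lo := hd (y - x) s (ltW s0) sd.
have {}lo : f (y + (y - x)) <= f y + s * M.
  by apply: lo => i; rewrite -opprB mxE normrN.
rewrite addrC subrK in up.
have mid := convex_half x (y + (y - x)) cf.
rewrite (_ : 2^-1 *: _ = y) in mid; last first.
  by apply/colP => i; rewrite !mxE; field.
by rewrite ltr_norml; apply/andP; split; lra.
Qed.

End convex.

(** * The radius function and the spherical-radial decomposition *)

Section radius.
Context {R : realType} {k : nat} {U : Type}.
Local Notation n := k.+1.
Variables (g : U -> 'cV[R]_n -> R) (m : 'cV[R]_n) (L : 'M[R]_n) (u : U).
Hypothesis g_convex : convex_ineq (g u).
Hypothesis gum_lt0 : g u m < 0.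

Let G (x : 'cV[R]_n) : R := g u (m + L *m x).

Let G_convex : convex_ineq G. Proof. exact: convex_ineq_affine. Qed.

Let G0 : G 0 < 0. Proof. by rewrite /G mulmx0 addr0. Qed.

Lemma ray_affine (r : R) (v : 'cV[R]_n) : g u (m + r *: (L *m v)) = G (r *: v).
Proof. by rewrite /G scalemxAr. Qed.

(* Along a ray the convex function is negative at 0, so its sublevel set is a closed interval. *)
Lemma rho_sublevel (v : 'cV[R]_n) (r : R) : 0 <= r ->
  (G (r *: v) <= 0) = (r%:E <= rho g m L u v)%E.
Proof.
move=> r0; apply/idP/idP => [Gr|rr].
  by apply: ereal_sup_ubound; exists r => //; split; rewrite ?ray_affine.
rewrite leNgt; apply/negP => Gr.
have r_gt0 : 0 < r.
  by rewrite lt0r r0 andbT; apply: contraTneq Gr => ->; rewrite scale0r -leNgt ltW.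
have cG : continuous (fun s : R => G (s *: v)).
  move=> s; apply: (@continuous_comp _ _ _ (fun s : R => s *: v) G).
    exact: scalel_continuous.
  exact: convex_continuous.
have : \forall s \near r, 0 < G (s *: v).
  exact: (@cvgr_gt _ _ (nbhs r) _ (fun s : R => G (s *: v)) (G (r *: v)) (cG r) 0 Gr).
move=> /nbhs_ballP[e /= e0 eG].
(* Near r the function is positive by continuity; further out it cannot return to a value <= 0, as
   convexity and G 0 < 0 would force G (r v) < 0. Hence no admissible radius exceeds r - e / 2. *)
have ub : (rho g m L u v <= (r - e / 2)%:E)%E.
  apply: ub_ereal_sup => _ [s [s0 Gs] <-]; rewrite lee_fin leNgt; apply/negP => rs.
  rewrite ray_affine in Gs.
  have [sr|sr] := ltP s (r + e).
    have /eG : ball r e s by rewrite /ball/= ltr_norml; apply/andP; split; lra.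
    by rewrite ltNge Gs.
  have s_gt0 : 0 < s by lra.
  have t0 : 0 <= r / s by rewrite divr_ge0.
  have t1 : r / s <= 1 by rewrite ler_pdivrMr// mul1r; lra.
  have := G_convex (s *: v) 0 t0 t1; rewrite scaler0 addr0 scalerA divfK ?gt_eqF//.
  by have := G0; nra.
have := le_trans rr ub; rewrite lee_fin; lra.
Qed.

Lemma rho_ge0 v : (0 <= rho g m L u v)%E.
Proof. by rewrite -rho_sublevel// scale0r ltW. Qed.

Variable gamma : probability (Rvec R n) R.
Hypothesis gammaN : std_normal_law gamma.
Local Open Scope ereal_scope.

(** Reading F_chi as the Gaussian measure of a ball, infinite radius included, makes its
    monotonicity and bounds properties of a probability. *)
Lemma chi_cdfE (r : \bar R) : 0 <= r ->
  (chi_cdf n r)%:E = gamma [set x : 'cV[R]_n | (enorm x)%:E <= r].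
Proof.
case: r => [r| |//] r0; first by rewrite (chi_cdf_enorm gammaN).
rewrite (_ : [set x | _] = setT); first by rewrite [RHS]probability_setT.
by apply/seteqP; split => x //= _; rewrite leey.
Qed.

Let measurable_enorm_le (r : \bar R) :
  measurable ([set x : 'cV[R]_n | (enorm x)%:E <= r] : set (Rvec R n)).
Proof.
have me : measurable_fun setT (fun x : Rvec R n => (enorm (x : 'cV[R]_n))%:E).
  by apply/measurable_EFinP; exact: measurable_enorm.
rewrite (_ : [set x | _] = setT `&` (fun x : Rvec R n => (enorm (x : 'cV[R]_n))%:E) @^-1` `]-oo, r]%classic).
  by apply: me => //; exact: emeasurable_itv.
by rewrite setTI; apply/seteqP; split => x /=; rewrite in_itv/=.
Qed.

Lemma chi_cdf_le (r s : \bar R) : 0 <= r -> r <= s -> (chi_cdf n r <= chi_cdf n s)%R.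
Proof.
move=> r0 rs; rewrite -lee_fin !chi_cdfE ?(le_trans r0)//.
by apply: le_measure; rewrite ?inE// => x /= /le_trans; apply.
Qed.

Lemma chi_cdf_ge0 (r : \bar R) : 0 <= r -> (0 <= chi_cdf n r)%R.
Proof. by move=> r0; rewrite -lee_fin chi_cdfE. Qed.

Lemma chi_cdf_le1 (r : \bar R) : 0 <= r -> (chi_cdf n r <= 1)%R.
Proof. by move=> r0; rewrite -lee_fin chi_cdfE// probability_le1. Qed.

Lemma chi_cdf_rho v : (chi_cdf n (rho g m L u v))%:E =
  gamma [set x : 'cV[R]_n | (G (enorm x *: v) <= 0)%R].
Proof.
rewrite chi_cdfE ?rho_ge0//; congr (gamma _); apply/seteqP.
by split => x /=; rewrite rho_sublevel// enorm_ge0.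
Qed.

Let measurable_sublevel :
  measurable ([set p | (G (dilate p) <= 0)%R] : set (Rvec R n * Rvec R n)).
Proof.
have mC : measurable ([set x | (G x <= 0)%R] : set (Rvec R n)).
  by apply: measurable_continuous_sublevel; exact: convex_continuous.
by have := measurable_dilate measurableT mC; rewrite setTI.
Qed.

(** Measurability of [rho] is bypassed: the composite is the [gamma]-mass of a section of a
    measurable set of pairs. *)
Lemma measurable_chi_cdf_rho :
  measurable_fun setT (fun v : Rvec R n => chi_cdf n (rho g m L u v)).
Proof.
apply/measurable_EFinP.
rewrite (_ : _ \o _ = fun v : Rvec R n => gamma (ysection
    ([set p | (G (dilate p) <= 0)%R] : set (Rvec R n * Rvec R n)) v)).
  exact: measurable_fun_ysection.
apply/funext => v /=; rewrite chi_cdf_rho; congr (gamma _).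
by apply/funext => x; apply/propext; rewrite /ysection/= inE.
Qed.

(* Two square roots of the covariance matrix differ by an orthogonal matrix,
   which the uniform law does not see. *)
Lemma spherical_radial_decomposition (A : 'M[R]_n) (sigma : probability (Rvec R n) R) :
  L \in unitmx -> A *m A^T = L *m L^T -> uniform_sphere_law sigma ->
  gamma [set x : 'cV[R]_n | (g u (m + A *m x) <= 0)%R] =
  \int[sigma]_v (chi_cdf n (rho g m L u v))%:E.
Proof.
move=> Lu AL sU; pose W := invmx L *m A.
have WW : W^T *m W = 1%:M.
  apply: mulmx1C; rewrite /W trmx_mul mulmxA -[_ *m A *m _]mulmxA AL mulmxA.
  by rewrite mulVmx// mul1mx -trmx_mul mulVmx// trmx1.
have LW : L *m W = A by rewrite mulmxA mulmxV// mul1mx.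
have mW := measurable_mulmx W.
have mF : measurable_fun setT (fun v : Rvec R n => (chi_cdf n (rho g m L u v))%:E).
  by apply/measurable_EFinP; exact: measurable_chi_cdf_rho.
rewrite (polar_decomposition gammaN sU); last first.
  by apply: convex_continuous; exact: convex_ineq_affine.
transitivity (\int[pushforward sigma (fun x : Rvec R n => W *m (x : 'cV[R]_n) : Rvec R n)]_v
    (chi_cdf n (rho g m L u v))%:E); last first.
  by apply: eq_measure_integral => B mB _; case: sU => _; exact.
rewrite ge0_integral_pushforward//; last first.
  by move=> v _; rewrite lee_fin chi_cdf_ge0// rho_ge0.
apply: eq_integral => v _; rewrite /= chi_cdf_rho; congr (gamma _).
by apply/funext => x; rewrite /G /= -LW -mulmxA -!scalemxAr.
Qed.

End radius.

(** * The variance of the spherical-radial estimator *)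

Theorem lemma3p2 (R : realType) (n : nat) (n_gt0 : (0 < n)%N)
    (U : completeNormedModType R) (g : U -> 'cV[R]_n -> R)
    (g_convex : forall u : U, convex_function [set: 'cV[R]_n] (g u))
    (m : 'cV[R]_n) (Sigma L : 'M[R]_n)
    (Sigma_nondegenerate : Sigma \in unitmx) (L_Sigma : L *m L^T = Sigma)
    (d : measure_display) (T : measurableType d) (P : probability T R)
    (zeta : {RV P >-> Rvec R n})
    (zeta_normal : normal_law m Sigma (distribution P zeta))
    (d' : measure_display) (T' : measurableType d') (Q : probability T' R)
    (theta : {RV Q >-> Rvec R n})
    (theta_uniform : uniform_sphere_law (distribution Q theta))
    (u : U) (gum_lt0 : g u m < 0) :
  let p := fine (P [set w | g u (zeta w) <= 0]) in
  (srd_variance g m L u Q theta <=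
   (Num.min ((1 - p) * (p - chi_cdf n (rho_inf g m L u)))
            (p * (chi_cdf n (rho_sup g m L u) - p)))%:E)%E.
Proof.
case: n n_gt0 g g_convex m Sigma L Sigma_nondegenerate L_Sigma zeta
  zeta_normal theta theta_uniform gum_lt0 => [//|k] _ g g_convex m Sigma L.
move=> Sigma_unit L_Sigma zeta [gamma [A [gammaN A_Sigma zetaE]]].
move=> theta theta_unif gm0.
pose p := fine (P [set w | g u (zeta w) <= 0]).
change (srd_variance g m L u Q theta <=
  (Num.min ((1 - p) * (p - chi_cdf k.+1 (rho_inf g m L u)))
           (p * (chi_cdf k.+1 (rho_sup g m L u) - p)))%:E)%E.
have cg := convex_function_ineq (g_convex u).
have L_unit : L \in unitmx.
  by move: Sigma_unit; rewrite -L_Sigma unitmx_mul => /andP[].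
pose F (v : Rvec R k.+1) : R := chi_cdf k.+1 (rho g m L u v).
have mF : measurable_fun setT F by exact: measurable_chi_cdf_rho gammaN.
pose X (w : T') : R := F (theta w).
have mX : measurable_fun setT X by exact: measurableT_comp.
have F0 v : 0 <= F v by apply: (chi_cdf_ge0 gammaN); exact: rho_ge0.
have F1 v : F v <= 1 by apply: (chi_cdf_le1 gammaN); exact: rho_ge0.
have EX : (\int[Q]_w (X w)%:E = p%:E)%E.
  have mC : measurable ([set x | g u x <= 0] : set (Rvec R k.+1)).
    by apply: measurable_continuous_sublevel; exact: convex_continuous.
  have PE : P [set w | g u (zeta w) <= 0] = (\int[Q]_w (X w)%:E)%E.
    transitivity (gamma [set x : 'cV[R]_k.+1 | g u (m + A *m x) <= 0]).
      by rewrite -(zetaE _ mC).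
    (* [A] comes from the definition of the normal law and may differ from [L]; both satisfy the
       same factorisation of [Sigma]. *)
    rewrite (spherical_radial_decomposition cg gm0 gammaN L_unit _ theta_unif); last first.
      by rewrite A_Sigma L_Sigma.
    by rewrite ge0_integral_distribution//; exact/measurable_EFinP.
  rewrite -PE fineK//; apply: fin_num_measure.
  exact: (measurable_funPTI zeta mC).
have VE : srd_variance g m L u Q theta = (\int[Q]_w ((X w - p) ^+ 2)%:E)%E.
  rewrite /srd_variance /variance unlock.
  have -> : fine 'E_Q[X]%E = p by rewrite unlock EX.
  by rewrite unlock.
have inf0 : (0 <= rho_inf g m L u)%E.
  by apply: le_ereal_inf_tmp => _ [v _ <-]; exact: rho_ge0.
(* The infimum and supremum of the radius run over the sphere, to which [theta] belongs only almost
   surely. *)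
have ae_sph : {ae Q, forall w, sphere (theta w)}.
  have [N [mN N0 sphN]] := ae_sphere theta_unif.
  exists (theta @^-1` N); split; [exact: measurable_funPTI|exact: N0|].
  by move=> w nw; exact: sphN.
have infX w : sphere (theta w) -> chi_cdf k.+1 (rho_inf g m L u) <= X w.
  by move=> sw; apply: (chi_cdf_le gammaN) => //; apply: ereal_inf_lbound; exists (theta w).
have supX w : sphere (theta w) -> X w <= chi_cdf k.+1 (rho_sup g m L u).
  move=> sw; apply: (chi_cdf_le gammaN); first exact: rho_ge0.
  by apply: ereal_sup_ubound; exists (theta w).
(* A point of the sphere is needed here, a supremum over the empty set being -oo. *)
have sup0 : (0 <= rho_sup g m L u)%E.
  apply: le_trans (rho_ge0 L cg gm0 (delta_mx 0 0)) _.
  by apply: ereal_sup_ubound; exists (delta_mx 0 0) => //; exact: enorm_delta_mx.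
rewrite VE minEle; case: ifP => _.
  apply: (bhatia_davis mX) EX; first exact: (chi_cdf_le1 gammaN).
  apply: (@filterS _ _ (ae_filter_ringOfSetsType Q) _ _ _ ae_sph) => w sw.
  by rewrite infX//= F1.
(* The factor p is read as p - 0, for the interval with lower end 0. *)
rewrite mulrC -[p in X in _ * X]subr0.
apply: (bhatia_davis mX) EX; first exact: (chi_cdf_ge0 gammaN).
apply: (@filterS _ _ (ae_filter_ringOfSetsType Q) _ _ _ ae_sph) => w sw.
by rewrite supX// F0.
Qed.
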